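(* Let $k\ge 0$. A cubespace $N$ is a degree-$k$ bundle (i.e. it carries the structure of a $k$-fold abelian bundle making it a degree-$k$ bundle) if and only if $N$ is a $k$-step nilspace. Furthermore, in this case $\mathcal{F}_i(N)$ is equal to the factor $T_i$ for every $1\le i\le k$ (that is, the fibers of the projection $\pi_i:N\to T_i$ are exactly the classes of $\sim_i$, and $C^n(T_i)=\pi_i(C^n(N))$ is the induced cubespace structure).
   Context: Notation: $0^n=(0,\dots,0)$ and $1^n=(1,\dots,1)$ in $\{0,1\}^n$. A cube morphism $\phi:\{0,1\}^n\to\{0,1\}^m$ is a map each of whose coordinate functions is one of $0$, $1$, $x_j$, $1-x_j$ for some $j$. A cubespace is a set $N$ with sets $C^n(N)\subseteq N^{\{0,1\}^n}$ ($n\ge 0$), whose elements are called cubes, such that $C^0(N)=N$ and (composition) if $\phi:\{0,1\}^n\to\{0,1\}^m$ is a cube morphism and $f\in C^m(N)$ then $f\circ\phi\in C^n(N)$. A nilspace is a cubespace with: (ergodicity) $C^1(N)=N^{\{0,1\}}$; (gluing) every map $f:\{0,1\}^n\setminus\{1^n\}\to N$ whose restrictions to the $(n-1)$-dimensional faces containing $0^n$ are all cubes extends to an element of $C^n(N)$. It is a $k$-step nilspace if in the gluing axiom for $n=k+1$ the extension is unique. For a nilspace $N$: $x\sim_k y$ iff there are $c_1,c_2\in C^{k+1}(N)$ with $c_1(0^{k+1})=x$, $c_2(0^{k+1})=y$ and $c_1(v)=c_2(v)$ for all $v\ne 0^{k+1}$. This is an equivalence relation, and $\mathcal{F}_k(N)=N/\sim_k$,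 whose cubes are the compositions of cubes of $N$ with the quotient map. For an abelian group $A$ and $k\ge1$, $\mathcal{D}_k(A)$ is the set $A$ with $f\in C^n(\mathcal{D}_k(A))$ iff $\sum_{v\in\{0,1\}^{k+1}}(-1)^{v_1+\dots+v_{k+1}}f(\phi(v))=0$ for every cube morphism $\phi:\{0,1\}^{k+1}\to\{0,1\}^n$. An $A$-bundle over a set $S$ is a set $T$ with a free action of the abelian group $A$ (written $x+a$) and a map $\pi:T\to S$ inducing a bijection between the $A$-orbits in $T$ and the elements of $S$. A $k$-fold abelian bundle with structure groups $A_1,\dots,A_k$ is the last member of a sequence $T_0,T_1,\dots,T_k$ (the factors) where $T_0$ is a one-point set and $T_i$ is an $A_i$-bundle over $T_{i-1}$; $\pi_j:T_i\to T_j$ ($i\ge j$) denote the composed projections. A degree-$k$ bundle is a cubespace $N$ that also has the structure of a $k$-fold abelian bundle with structure groups $A_1,\dots,A_k$ and factors $T_0,\dots,T_k=N$ such that for every $0\le i\le k-1$, $n\in\mathbb{N}$ and $c\in C^n(T_{i+1})$, $$\{c_2\in C^n(T_{i+1}) : \pi_i\circ c=\pi_i\circ c_2\}=\{c+c_3 : c_3\in C^n(\mathcal{D}_{i+1}(A_{i+1}))\},$$ where $C^n(T_i)=\pi_i(C^n(N))$ (composition with $\pi_i$) and $c+c_3$ is the pointwise action. *)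

(* Defs.v *)
From mathcomp Require Import all_boot all_order all_algebra.
From mathcomp Require Import boolp classical_sets.

Set Implicit Arguments.
Unset Strict Implicit.
Unset Printing Implicit Defensive.

Import GRing.Theory.
Local Open Scope classical_set_scope.
Local Open Scope ring_scope.

Definition cube (n : nat) := {ffun 'I_n -> bool}.

Definition cube0 (n : nat) : cube n := [ffun=> false].
Definition cube1 (n : nat) : cube n := [ffun=> true].

Definition coordinate_map (n : nat) (p : cube n -> bool) : Prop :=
  [\/ p =1 (fun=> false), p =1 (fun=> true),
      exists j : 'I_n, p =1 (fun x => x j) |
      exists j : 'I_n, p =1 (fun x => ~~ x j)].

Definition cube_morphism (n m : nat) (phi : cube n -> cube m) : Prop :=
  forall i : 'I_m, coordinate_map (fun x => phi x i).

Record cubespace := Cubespace {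
  points :> Type;
  cubes : forall n : nat, set (cube n -> points);
  cubes_dim0 : @cubes 0 = setT;
  cubes_comp : forall (n m : nat) (phi : cube n -> cube m) (f : cube m -> points),
    cube_morphism phi -> cubes f -> cubes (f \o phi)
}.
Arguments cubes : clear implicits.

(* The coordinates of the face {v | v i = 0} other than i are numbered in      *)
(* increasing order, which identifies the face with {0,1}^(n-1).              *)
Definition face0 (n : nat) (i : 'I_n) (w : cube n.-1) : cube n :=
  [ffun j => if unlift i j is Some j' then w j' else false].

Lemma face0_neq1 (n : nat) (i : 'I_n) (w : cube n.-1) :
  face0 i w != cube1 n.
Proof.
by apply/eqP => /ffunP/(_ i); rewrite !ffunE unlift_none.
Qed.

Definition corner (n : nat) := {v : cube n | v != cube1 n}.

Definition corner_face (n : nat) (i : 'I_n) (w : cube n.-1) : corner n :=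
  exist _ (face0 i w) (face0_neq1 i w).

Definition gluable (N : cubespace) (n : nat) (f : corner n -> N) : Prop :=
  forall i : 'I_n, cubes N n.-1 (f \o corner_face i).

Definition completes (N : cubespace) (n : nat) (f : corner n -> N)
    (g : cube n -> N) : Prop :=
  cubes N n g /\ (forall v : corner n, g (val v) = f v).

(* Gluing is required for every n, including n = 0, where the corner is empty *)
(* and the axiom says that the nilspace has a point.                          *)
Definition nilspace (N : cubespace) : Prop :=
  cubes N 1 = setT /\
  (forall (n : nat) (f : corner n -> N),
     gluable f -> exists g : cube n -> N, completes f g).

Definition step_nilspace (k : nat) (N : cubespace) : Prop :=
  nilspace N /\
  (forall f : corner k.+1 -> N,
     gluable f -> exists! g : cube k.+1 -> N, completes f g).

Definition nil_rel (N : cubespace) (k : nat) (x y : N) : Prop :=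
  exists c1 c2 : cube k.+1 -> N,
    [/\ cubes N k.+1 c1, cubes N k.+1 c2,
        c1 (cube0 k.+1) = x, c2 (cube0 k.+1) = y &
        forall v : cube k.+1, v != cube0 k.+1 -> c1 v = c2 v].

Definition nil_class (N : cubespace) (k : nat) : Type :=
  {S : set N | exists x : N, S = [set y | nil_rel k x y]}.

Definition to_class (N : cubespace) (k : nat) (x : N) : nil_class N k :=
  exist _ [set y | nil_rel k x y] (ex_intro _ x erefl).

Definition class_cubes (N : cubespace) (k n : nat) :
    set (cube n -> nil_class N k) :=
  [set @to_class N k \o c | c in cubes N n].
Arguments class_cubes : clear implicits.

Lemma class_cubes_dim0 (N : cubespace) (k : nat) :
  class_cubes N k 0 = setT.
Proof.
apply/seteqP; split=> // f _.
case E: (f (cube0 0)) => [S [x Sx]].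
exists (fun=> x); first by rewrite cubes_dim0.
apply/funext => v /=.
have -> : v = cube0 0 by apply/ffunP => -[].
by rewrite E; apply: eq_exist.
Qed.

Lemma class_cubes_comp (N : cubespace) (k n m : nat)
    (phi : cube n -> cube m) (f : cube m -> nil_class N k) :
  cube_morphism phi -> class_cubes N k m f -> class_cubes N k n (f \o phi).
Proof.
move=> phiP [c cP <-]; exists (c \o phi) => //.
exact: cubes_comp.
Qed.

Definition nil_factor (N : cubespace) (k : nat) : cubespace :=
  Cubespace (class_cubes_dim0 N k) (@class_cubes_comp N k).

Definition group_cubes (k : nat) (A : zmodType) (n : nat) : set (cube n -> A) :=
  [set f | forall phi : cube k.+1 -> cube n, cube_morphism phi ->
     \sum_(v : cube k.+1)
        f (phi v) *~ ((-1) ^+ (\sum_(i < k.+1) v i)%N) = 0].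

Record abelian_bundle (A : zmodType) (S T : Type) := AbelianBundle {
  act : T -> A -> T;
  bundle_proj : T -> S;
  act0 : forall x : T, act x 0 = x;
  actD : forall (x : T) (a b : A), act x (a + b) = act (act x a) b;
  act_free : forall (x : T) (a : A), act x a = x -> a = 0;
  bundle_proj_orbit : forall x y : T,
    bundle_proj x = bundle_proj y <-> exists a : A, y = act x a;
  bundle_proj_surj : forall s : S, exists x : T, bundle_proj x = s
}.

(* A structure of k-fold abelian bundle on the set N. The families are indexed *)
(* by nat, but only factor i for i <= k and group i for 1 <= i <= k are used.  *)
(* N is identified with factor k through proj k; the other maps proj i are    *)
(* then forced to be the composed projections.                                *)
Record fold_bundle (k : nat) (N : Type) := FoldBundle {
  factor : nat -> Type;
  group : nat -> zmodType;
  bundle : forall i : nat, (i < k)%N ->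
    abelian_bundle (group i.+1) (factor i) (factor i.+1);
  proj : forall i : nat, N -> factor i;
  factor0_point : exists t0 : factor 0, forall t : factor 0, t = t0;
  proj_top : bijective (proj k);
  projS : forall (i : nat) (ik : (i < k)%N) (x : N),
    proj i x = bundle_proj (bundle ik) (proj i.+1 x)
}.

Definition factor_cubes (k : nat) (N : cubespace) (B : fold_bundle k N)
    (i n : nat) : set (cube n -> factor B i) :=
  [set @proj k N B i \o c | c in cubes N n].

Definition degree_bundle (k : nat) (N : cubespace) (B : fold_bundle k N) : Prop :=
  forall (i : nat) (ik : (i < k)%N) (n : nat) (c : cube n -> factor B i.+1),
    factor_cubes c ->
    [set c2 : cube n -> factor B i.+1 | factor_cubes c2 /\
       bundle_proj (bundle B ik) \o c = bundle_proj (bundle B ik) \o c2]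
    = [set (fun v => act (bundle B ik) (c v) (c3 v))
        | c3 in @group_cubes i.+1 (group B i.+1) n].

Definition is_degree_bundle (k : nat) (N : cubespace) : Prop :=
  exists B : fold_bundle k N, degree_bundle B.

(* The i-th factor of B is F_i(N): same fibres over N, and the resulting      *)
(* identification of points is an isomorphism of cubespaces.                  *)
Definition factor_is_nil_factor (k : nat) (N : cubespace) (B : fold_bundle k N)
    (i : nat) : Prop :=
  (forall x y : N, proj B i x = proj B i y <-> nil_rel i x y) /\
  (exists h : nil_factor N i -> factor B i,
     [/\ bijective h,
         forall x : N, h (to_class i x) = proj B i x &
         forall (n : nat) (f : cube n -> nil_factor N i),
           cubes (nil_factor N i) n f <-> factor_cubes (h \o f)]).

(* Main.v *)
(* The combinatorial tool is simplicial extension: a partial cube given on a downset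
   of {0,1}^I whose restrictions to all faces [0, v] are cubes extends to a cube,
   by gluing one minimal missing vertex at a time. With downsets of larger cubes
   it yields the tricube lemma, hence x ~_k y iff the (k+1)-cube equal to y at one
   vertex and to x elsewhere is a cube, and hence that the values of a cube of
   dimension at most k+1 may be replaced freely within their ~_k-classes.

   From a bundle to a nilspace: by induction on the factors, a corner of T_(i+1) is
   glued by gluing its projection to T_i, lifting, and correcting the lift by a
   corner of D_(i+1)(A), which extends because the cubes of D_(i+1)(A) are the
   multilinear polynomials of degree at most i+1.

   From a nilspace to a bundle: take T_i = F_i(N). In a (k+1)-step nilspace M, a
   class F of ~_k with base point e becomes a group acting on M, x + a being the
   unique y that makes a (k+2)-cube out of (e,...,e,a) and (x,...,x,y). Simplicial
   extension shows that adding a on a face of codimension at most k+1 preserves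
   cubes; this gives associativity, commutativity and, through the decomposition
   into monomials, the fibres of C^n(M) over C^n(F_k(M)). *)
Require Import Defs.
From HB Require Import structures.
From mathcomp Require Import all_boot all_order all_algebra.
From mathcomp Require Import boolp classical_sets.

Set Implicit Arguments.
Unset Strict Implicit.
Unset Printing Implicit Defensive.

Import GRing.Theory.
Local Open Scope classical_set_scope.

Definition bcube (I : finType) := {ffun I -> bool}.
Definition top (I : finType) : bcube I := [ffun=> true].
Definition bot (I : finType) : bcube I := [ffun=> false].
(** For fixed [v] this retracts the cube onto its face [0, v], so that restriction to a face needs
    no renumbering of coordinates. *)
Definition meet (I : finType) (v w : bcube I) : bcube I := [ffun i => w i && v i].

Definition antipode (I : finType) (v : bcube I) : bcube I := [ffun i => ~~ v i].

Definition gcoord (I : finType) (p : bcube I -> bool) : Prop :=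
  [\/ p =1 (fun=> false), p =1 (fun=> true),
      exists i : I, p =1 (fun x => x i) |
      exists i : I, p =1 (fun x => ~~ x i)].

Definition gmor (I J : finType) (phi : bcube I -> bcube J) : Prop :=
  forall j, gcoord (fun x => phi x j).

(** * Cubes over finite index types *)

Section Morphisms.
Implicit Types I J L : finType.

Lemma gcoord_const I (b : bool) : gcoord (fun _ : bcube I => b).
Proof. by case: b; [constructor 2 | constructor 1]. Qed.

Lemma gcoord_var I (i : I) : gcoord (fun x : bcube I => x i).
Proof. by constructor 3; exists i. Qed.

Lemma gcoordN I (p : bcube I -> bool) : gcoord p -> gcoord (fun x => ~~ p x).
Proof.
case=> [e|e|[i e]|[i e]].
- by constructor 2 => x; rewrite e.
- by constructor 1 => x; rewrite e.
- by constructor 4; exists i => x; rewrite e.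
- by constructor 3; exists i => x; rewrite e negbK.
Qed.

Lemma gcoord_and I (b : bool) (p : bcube I -> bool) :
  gcoord p -> gcoord (fun x => p x && b).
Proof.
by move=> cp; case: b; [under eq_fun do rewrite andbT | under eq_fun do
  rewrite andbF; exact: gcoord_const].
Qed.

Lemma gcoord_comp I J (phi : bcube I -> bcube J) (p : bcube J -> bool) :
  gmor phi -> gcoord p -> gcoord (p \o phi).
Proof.
move=> hphi [e|e|[j e]|[j e]].
- by constructor 1 => x; rewrite /= e.
- by constructor 2 => x; rewrite /= e.
- by have -> : p \o phi = (fun x => phi x j) by apply/funext => x; rewrite /= e.
- have -> : p \o phi = (fun x => ~~ phi x j) by apply/funext => x; rewrite /= e.
  exact: gcoordN.
Qed.

Lemma gmor_ffun I J (F : J -> bcube I -> bool) :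
  (forall j, gcoord (F j)) -> gmor (fun x => [ffun j => F j x]).
Proof. by move=> h j; under eq_fun do rewrite ffunE. Qed.

Lemma gmor_id I : gmor (@id (bcube I)).
Proof. by move=> i; apply: gcoord_var. Qed.

Lemma gmor_comp I J L (phi : bcube J -> bcube L) (psi : bcube I -> bcube J) :
  gmor phi -> gmor psi -> gmor (phi \o psi).
Proof. by move=> hphi hpsi l; apply: (gcoord_comp hpsi (hphi l)). Qed.

Lemma gmor_const I J (v : bcube J) : gmor (fun _ : bcube I => v).
Proof. by move=> j; apply: gcoord_const. Qed.

Lemma gmor_meet I (v : bcube I) : gmor (meet v).
Proof. by apply: gmor_ffun => i; apply/gcoord_and/gcoord_var. Qed.

Lemma gmor_antipode I : gmor (@antipode I).
Proof. by apply: gmor_ffun => i; apply/gcoordN/gcoord_var. Qed.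

Lemma gmor_res I J (e : J -> I) :
  gmor (fun w : bcube I => [ffun j => w (e j)] : bcube J).
Proof. by apply: gmor_ffun => j; apply: gcoord_var. Qed.

Lemma gmor_face0 n (i : 'I_n) : gmor (face0 i).
Proof.
apply: (gmor_ffun (F := fun j w => if unlift i j is Some j' then w j' else false)).
by move=> j; case: unlift => [j'|]; [apply: gcoord_var | apply: gcoord_const].
Qed.

Definition pinv I J (e : J -> I) (i : I) : option J := [pick j | e j == i].

Lemma pinvK I J (e : J -> I) : injective e -> pcancel e (pinv e).
Proof.
rewrite /pinv => inje j; case: pickP => [j' /eqP/inje-> //|].
by move/(_ j); rewrite eqxx.
Qed.

Lemma pinv_some I J (e : J -> I) i j : pinv e i = Some j -> e j = i.
Proof. by rewrite /pinv; case: pickP => // j' /eqP <- [->]. Qed.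

(** Parametrizes the face through [b] whose free coordinates are the image of [e]; the other
    coordinates are frozen as in [b]. *)
Definition ext I J (e : J -> I) (b : bcube I) (w : bcube J) : bcube I :=
  [ffun i => if pinv e i is Some j then w j else b i].

Lemma gmor_ext I J (e : J -> I) b : gmor (ext e b).
Proof.
apply: (gmor_ffun (F := fun i w => if pinv e i is Some j then w j else b i)).
by move=> i; case: pinv => [j|]; [apply: gcoord_var | apply: gcoord_const].
Qed.

Lemma extK I J (e : J -> I) b w j : injective e -> ext e b w (e j) = w j.
Proof. by move=> inje; rewrite ffunE pinvK. Qed.

Lemma meet_top I (v : bcube I) : meet (top I) v = v.
Proof. by apply/ffunP => i; rewrite !ffunE andbT. Qed.

Lemma meet_idl I (v w : bcube I) : (forall i, w i -> v i) -> meet v w = w.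
Proof.
by move=> h; apply/ffunP => i; rewrite ffunE; case E: (w i) => //=; rewrite h.
Qed.

Lemma meet_le I (v w : bcube I) i : meet v w i -> v i.
Proof. by rewrite ffunE => /andP[]. Qed.

Lemma neq_top I (v : bcube I) : v != top I -> exists i, ~~ v i.
Proof.
move=> nv; apply/existsP; apply: contraNT nv => /existsPn h.
by apply/eqP/ffunP => i; rewrite ffunE; apply/negPn/h.
Qed.

End Morphisms.

Lemma card_below (I : finType) (u v : bcube I) : (forall i, u i -> v i) -> u != v ->
  #|[pred i | u i]| < #|[pred i | v i]|.
Proof.
move=> uv nuv; apply: proper_card; apply/fintype.properP; split.
  by apply/fintype.subsetP => i; apply: uv.
have [i vi ui] : exists2 i, v i & ~~ u i.
  apply/exists_inP; apply: contraNT nuv => /exists_inPn h.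
  by apply/eqP/ffunP => i; apply/idP/idP => [/uv|/h/negPn].
by exists i.
Qed.

(* Cubes indexed by an arbitrary finite type: auxiliary cubes of shape I * bool
   or I + J are then available without renumbering coordinates. *)
Definition gcube (N : cubespace) (I : finType) (f : bcube I -> N) : Prop :=
  forall n (phi : cube n -> bcube I), @gmor 'I_n I phi -> cubes N n (f \o phi).

Section GCubes.
Variable N : cubespace.
Implicit Types I J L : finType.

Lemma gcube_comp I J (phi : bcube I -> bcube J) (f : bcube J -> N) :
  gmor phi -> gcube f -> gcube (f \o phi).
Proof. by move=> hphi hf n psi hpsi; apply: hf (gmor_comp hphi hpsi). Qed.

Lemma gcube_ord n (f : cube n -> N) : @gcube N 'I_n f <-> cubes N n f.
Proof.
split=> [hf|hf m phi hphi]; last exact: cubes_comp.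
exact: (hf _ id (@gmor_id _)).
Qed.

Lemma gcube_eq I (f g : bcube I -> N) : f =1 g -> gcube f -> gcube g.
Proof. by move=> /funext->. Qed.

Lemma gcube_pull I J (phi : bcube I -> bcube J) (f : bcube J -> N) g :
  gcube f -> gmor phi -> g =1 f \o phi -> gcube g.
Proof. by move=> hf hphi /funext->; apply: gcube_comp. Qed.

Lemma gcube_const I (x : N) : gcube (fun _ : bcube I => x).
Proof.
have h0 : @gcube N 'I_0 (fun=> x) by apply/gcube_ord; rewrite cubes_dim0.
exact: (gcube_comp (gmor_const I (bot 'I_0)) h0).
Qed.

Definition to_ord I (w : bcube I) : cube #|I| := [ffun j => w (enum_val j)].
Definition of_ord I (w : cube #|I|) : bcube I := [ffun i => w (enum_rank i)].

Lemma gmor_to_ord I : @gmor I 'I_#|I| (@to_ord I).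
Proof. exact: gmor_res. Qed.

Lemma gmor_of_ord I : @gmor 'I_#|I| I (@of_ord I).
Proof. exact: gmor_res. Qed.

Lemma to_ordK I : cancel (@to_ord I) (@of_ord I).
Proof. by move=> w; apply/ffunP => i; rewrite !ffunE enum_rankK. Qed.

End GCubes.

(** * The nilspace axioms in terms of total maps *)

(** The value of [f] at the top vertex is arbitrary: no [face0 i] meets that vertex. For n = 0 this
    says nothing, so the existence of a point has to be recorded separately. *)
Definition gluing (N : cubespace) : Prop :=
  forall n (f : cube n -> N), (forall i, cubes N n.-1 (f \o face0 i)) ->
    exists2 g, cubes N n g & forall v, v != cube1 n -> g v = f v.

Definition unique_completion (k : nat) (N : cubespace) : Prop :=
  forall c c', cubes N k.+1 c -> cubes N k.+1 c' ->
    (forall v, v != cube1 k.+1 -> c v = c' v) -> c (cube1 k.+1) = c' (cube1 k.+1).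

Lemma nilspaceP (N : cubespace) :
  nilspace N <-> [/\ inhabited N, cubes N 1 = setT & gluing N].
Proof.
split=> [[erg glu]|[[x0] erg glu]].
  have no_corner (v : corner 0) : False.
    by case: v => v /eqP; apply; apply/ffunP => -[].
  have [|x0 _] := glu 0 (fun v => False_rect N (no_corner v)); first by case.
  split=> //; first exact: inhabits (x0 (cube0 0)).
  move=> n f hf; have [|g [gN gf]] := glu n (f \o val) => //.
  by exists g => // v nv; rewrite (gf (exist _ v nv)).
split=> // n f hf.
pose F v := if insub v is Some u then f u else x0.
have FE : F \o val = f by apply/funext => u; rewrite /F /= valK.
have [i|g gN gF] := glu n F.
  suff -> : F \o face0 i = f \o corner_face i by apply: hf.
  by rewrite -FE.
by exists g; split=> // u; rewrite gF ?(valP u)// -FE.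
Qed.

Lemma step_nilspaceP k (N : cubespace) :
  step_nilspace k N <-> nilspace N /\ unique_completion k N.
Proof.
split=> [[nN uN]|[nN uN]]; split=> //.
  move=> c c' cN c'N cc'.
  have [|g [_ gu]] := uN (c \o val).
    by move=> i; apply: cubes_comp (gmor_face0 i) cN.
  rewrite -(gu c)// -(gu c')//; split=> // -[v nv] /=; exact/esym/cc'.
move=> f /(proj2 nN)[g gf]; exists g; split=> // g' g'f; apply/funext => v.
have e w : w != cube1 k.+1 -> g w = g' w.
  by move=> nw; rewrite (proj2 gf (exist _ w nw)) (proj2 g'f (exist _ w nw)).
have [->|/e//] := eqVneq v (cube1 k.+1).
by apply: uN e; [case: gf | case: g'f].
Qed.

Definition upd (T : eqType) U (f : T -> U) (t : T) (u : U) : T -> U :=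
  fun s => if s == t then u else f s.

Lemma upd_same (T : eqType) U (f : T -> U) t u : upd f t u t = u.
Proof. by rewrite /upd eqxx. Qed.

(** * Simplicial extension and the tricube lemma *)

Section Extension.
Variable N : cubespace.
Hypothesis nN : nilspace N.

(* Gluing on the face [{u | u <= v}]; composing with [meet v], the retraction
   onto that face, expresses that a map restricts to a cube on it. *)
Lemma gluing_face (I : finType) (v : bcube I) (f : bcube I -> N) :
  (forall u : bcube I, (forall i, u i -> v i) -> u != v -> gcube (f \o meet u)) ->
  exists x, gcube (upd f v x \o meet v).
Proof.
move=> hf; have [_ _ glu] := (nilspaceP N).1 nN.
pose m := #|[pred i | v i]|; pose e : 'I_m -> I := enum_val.
have inje : injective e by apply: enum_val_inj.
have ve j : v (e j) by have := enum_valP j.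
have ev i : v i -> exists j, e j = i.
  by move=> vi; exists (enum_rank_in (A := [pred i | v i]) vi i); apply: enum_rankK_in.
have [|g gN gf] := glu m (f \o ext e (bot I)).
  move=> j; pose u : bcube I := [ffun i => v i && (i != e j)].
  have hu : gcube (f \o meet u).
    apply: hf => [i|]; first by rewrite ffunE => /andP[].
    by apply/eqP => /ffunP/(_ (e j)); rewrite ffunE eqxx ve.
  have -> : f \o ext e (bot I) \o face0 j = (f \o meet u) \o (ext e (bot I) \o face0 j).
    apply/funext => w /=; congr f; apply/esym/meet_idl => i.
    rewrite !ffunE; case E: (pinv e i) => [j'|] //.
    rewrite -(pinv_some E) ve ffunE (inj_eq inje).
    by case: unliftP => //= j'' ->; rewrite eq_sym neq_lift.
  by apply: hu; apply: gmor_comp; [apply: gmor_ext | apply: gmor_face0].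
exists (g (cube1 m)); apply: (gcube_pull (I := I) (J := 'I_m) (f := g)) (gmor_res e) _.
  exact/gcube_ord.
move=> w /=; set r := [ffun j => _].
have ew : meet v w = ext e (bot I) r.
  apply/ffunP => i; rewrite !ffunE; case E: (pinv e i) => [j|].
    by rewrite -(pinv_some E) ve ffunE andbT.
  apply/negP => /andP[_ /ev[j ej]].
  by move: E; rewrite -ej pinvK.
have rw j : r j = meet v w (e j) by rewrite !ffunE ve andbT.
rewrite /upd; case: ifPn => [/eqP wv|nwv].
  by congr g; apply/ffunP => j; rewrite rw wv ve ffunE.
rewrite ew gf //; apply: contraNneq nwv => r1.
apply/eqP/ffunP => i; rewrite ew ffunE; case E: (pinv e i) => [j|].
  by rewrite -(pinv_some E) ve r1 ffunE.
by rewrite ffunE; apply/esym/negP => /ev[j ej]; move: E; rewrite -ej pinvK.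
Qed.

Lemma extend (I : finType) (P : pred (bcube I)) (f : bcube I -> N) :
  (forall u v : bcube I, P v -> (forall i, u i -> v i) -> P u) ->
  (forall v, P v -> gcube (f \o meet v)) ->
  exists2 g, gcube g & forall v, P v -> g v = f v.
Proof.
have [m] := ubnP #|[pred v | ~~ P v]|; elim: m => // m IH in P f *.
move=> hm dP hf.
have [allP|/forallPn[v0 nP0]] := boolP [forall v, P v].
  exists f => //; apply: gcube_eq (hf (top I) _) => [w /=|]; last exact/forallP.
  by rewrite meet_top.
(* A missing vertex with the fewest ones: everything strictly below it lies in [P], so [gluing_face]
   fills it, and [P] with [v] added is again a downset. *)
have [v nPv vmin] := @arg_minnP _ v0 (fun v => ~~ P v) (fun v => #|[pred i | v i]|) nP0.
have below (u : bcube I) : (forall i, u i -> v i) -> u != v -> P u.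
  move=> uv nuv; apply/negPn/negP => /vmin; rewrite leqNgt => /negP; apply.
  exact: card_below.
have [|x hx] := @gluing_face I v f; first by move=> u uv nuv; apply/hf/below.
have [||w wv|g gN gE] := IH (fun w => P w || (w == v)) (upd f v x).
- move: hm; rewrite ltnS; apply: leq_trans; apply: proper_card; apply/fintype.properP; split.
    by apply/fintype.subsetP => w; rewrite !inE negb_or => /andP[].
  by exists v; rewrite !inE ?eqxx ?orbT.
- move=> u w /orP[Pw uw|/eqP-> uv]; first by rewrite (dP _ _ Pw uw).
  by have [->|nuv] := eqVneq u v; [rewrite orbT | rewrite below].
- have [->//|nwv] := eqVneq w v.
  move: wv; rewrite (negPf nwv) orbF => Pw.
  apply: gcube_eq (hf _ Pw) => u /=; rewrite /upd ifN //.
  by apply: contraNneq nPv => <-; apply: dP Pw _ => i; apply: meet_le.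
exists g => // w Pw; rewrite gE ?Pw// /upd ifN //.
by apply: contraNneq nPv => <-.
Qed.

(* The points [w] of the cube over [I * bool] for which no [i] has both
   [w (i, false)] and [w (i, true)] form a downset isomorphic to {-1,0,1}^I, and
   [c s] is the datum on the orthant of signs [s]. The outer vertices lie on the
   image of the morphism sending [s] to the indicator of its graph. *)
Lemma tricube (I : finType) (c : bcube I -> bcube I -> N) :
  (forall s, gcube (c s)) ->
  (forall s s' w : bcube I, (forall i, w i -> s i = s' i) -> c s w = c s' w) ->
  gcube (fun s => c s (top I)).
Proof.
move=> hc cc.
pose P (w : bcube (I * bool)%type) := [forall i, ~~ (w (i, false) && w (i, true))].
pose sg (w : bcube (I * bool)%type) : bcube I := [ffun i => w (i, true)].
pose u (w : bcube (I * bool)%type) : bcube I := [ffun i => w (i, false) || w (i, true)].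
have [w v /forallP Pv wv|v /forallP Pv|g gN gE] :=
  @extend (I * bool)%type P (fun w => c (sg w) (u w)).
- apply/forallP => i; apply: contra (Pv i) => /andP[/wv-> /wv->] //.
(* On the face [0, v] at most one of the two coordinates over each i varies, so [u] is a morphism
   there; wherever [u] is 1 the signs agree with those of [v]. *)
- apply: (gcube_pull (hc (sg v)) (phi := u \o meet v)) => [|w /=].
    move=> i; under eq_fun do rewrite !ffunE.
    have := Pv i; case: (v (i, false)); case: (v (i, true)) => //= _.
    + by under eq_fun do rewrite andbF andbT orbF; apply: gcoord_var.
    + by under eq_fun do rewrite andbF andbT; apply: gcoord_var.
    + by under eq_fun do rewrite !andbF; apply: gcoord_const.
  apply: cc => i; rewrite !ffunE; have := Pv i.
  by case: (v (i, false)); case: (v (i, true)) => //= _; rewrite ?andbF ?andbT ?orbF.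
apply: (gcube_pull gN (phi := fun s => [ffun p => s p.1 == p.2])).
  apply: gmor_ffun => -[i []] /=.
    by under eq_fun do rewrite eqb_id; apply: gcoord_var.
  by under eq_fun do rewrite eqbF_neg; apply/gcoordN/gcoord_var.
move=> s /=; rewrite gE; last first.
  by apply/forallP => i; rewrite !ffunE /=; case: (s i).
congr c; apply/ffunP => i; rewrite !ffunE /=; by case: (s i).
Qed.

End Extension.

(** * Conditions on few coordinates; uniqueness on faces *)

(** [psi] lists the coordinates in [A] and pads with the constant 1. Through it a cube singling out
    the top of {0,1}^m singles out any face of codimension at most m. *)
Lemma gmor_all (I : finType) (A : pred I) m : #|A| <= m ->
  exists2 psi : bcube I -> bcube 'I_m, gmor psi &
    forall w, (psi w == top 'I_m) = [forall i in A, w i].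
Proof.
move=> hA; exists (fun w => [ffun j : 'I_m =>
  if onth (enum A) j is Some i then w i else true]).
  apply: (gmor_ffun (F := fun (j : 'I_m) w => if onth (enum A) j is Some i then w i else true)).
  by move=> j; case: onth => [i|]; [apply: gcoord_var | apply: gcoord_const].
move=> w; apply/eqP/forall_inP => [/ffunP h i Ai|h].
  have ji : index i (enum A) < m by rewrite (leq_trans _ hA)// cardE index_mem mem_enum.
  have := h (Ordinal ji); rewrite !ffunE /=.
  by rewrite (onthE) (nth_map i) ?index_mem ?mem_enum// nth_index ?mem_enum.
apply/ffunP => j; rewrite !ffunE; case E: onth => [i|//].
apply: h; have : i \in enum A by apply/onthP; exists j.
by rewrite mem_enum.
Qed.

(* Apply uniqueness on a (k + 1)-dimensional face with top vertex [v]. *)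
Lemma unique_below k (M : cubespace) (I : finType) (f f' : bcube I -> M) (v : bcube I) :
  unique_completion k M -> gcube f -> gcube f' -> k < #|[pred i | v i]| ->
  (forall u : bcube I, (forall i, u i -> v i) -> u != v -> f u = f' u) -> f v = f' v.
Proof.
move=> uM hf hf' kv ff'.
pose e (j : 'I_k.+1) : I := enum_val (widen_ord kv j).
have inje : injective e by move=> j j' /enum_val_inj /(congr1 val) /= /val_inj.
have ve j : v (e j) by have := enum_valP (widen_ord kv j).
have e1 : ext e v (top _) = v.
  apply/ffunP => i; rewrite ffunE; case E: pinv => [j|//].
  by rewrite -(pinv_some E) ve ffunE.
rewrite -e1; apply: (uM (f \o ext e v) (f' \o ext e v)).
- by apply: hf; apply: gmor_ext.
- by apply: hf'; apply: gmor_ext.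
move=> w nw /=; apply: ff' => [i|].
  by rewrite ffunE; case E: pinv => [j|//] _; rewrite -(pinv_some E).
apply: contraNneq nw => wv; apply/eqP/ffunP => j.
by rewrite -(extK v w j inje) wv ve ffunE.
Qed.

Lemma unique_top k (M : cubespace) (I : finType) (f f' : bcube I -> M) :
  unique_completion k M -> gcube f -> gcube f' -> k < #|I| ->
  (forall u, u != top I -> f u = f' u) -> f (top I) = f' (top I).
Proof.
move=> uM hf hf' kI ff'; apply: (unique_below uM) => // [|u _]; last exact: ff'.
by rewrite (eq_card (B := I))// => i; rewrite !inE ffunE.
Qed.

Lemma unique_completionS k (M : cubespace) :
  unique_completion k M -> unique_completion k.+1 M.
Proof.
move=> uM c c' cM c'M cc'; apply: (unique_top (I := 'I_k.+2) uM) => //.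
- exact/gcube_ord.
- exact/gcube_ord.
- by rewrite card_ord.
Qed.

Definition pt (T : Type) (I : finType) (x y : T) (w : bcube I) : T :=
  if w == top I then y else x.

Lemma pt_top T I (x y : T) : pt x y (top I) = y.
Proof. by rewrite /pt eqxx. Qed.

Lemma pt_neq T I (x y : T) (w : bcube I) : w != top I -> pt x y w = x.
Proof. by rewrite /pt => /negPf->. Qed.

Lemma antipodeK I : involutive (@antipode I).
Proof. by move=> v; apply/ffunP => i; rewrite !ffunE negbK. Qed.

Lemma antipode_top I : antipode (top I) = bot I.
Proof. by apply/ffunP => i; rewrite !ffunE. Qed.

Lemma antipode_bot I : antipode (bot I) = top I.
Proof. by rewrite -antipode_top antipodeK. Qed.

Lemma antipode_eq_bot I (v : bcube I) : (antipode v == bot I) = (v == top I).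
Proof. by rewrite -antipode_top (can_eq (@antipodeK I)). Qed.

(** * The relations ~_k *)

Section NilRel.
Variable N : cubespace.
Hypothesis nN : nilspace N.

Lemma nil_relP k (x y : N) : nil_rel k x y <-> gcube (pt x y : bcube 'I_k.+1 -> N).
Proof.
split=> [[c1 [c2 [c1N c2N <- <- c12]]]|h].
  (* A tricube with [c2] in the top orthant and [c1] in all others, reflected so that the vertex 0,
     where the two may differ, becomes the outer one. The outer cube is then [pt x y]. *)
  pose c (s : bcube 'I_k.+1) := (if s == top _ then c2 else c1) \o @antipode 'I_k.+1.
  have hc s : gcube (c s).
    rewrite /c; case: ifP => _; apply: (gcube_comp (J := 'I_k.+1) (gmor_antipode (I := 'I_k.+1)));
    exact/gcube_ord.
  have c12' w : w != top _ -> c1 (@antipode 'I_k.+1 w) = c2 (@antipode 'I_k.+1 w).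
    move=> nw; apply: c12; have := antipode_eq_bot w.
    by rewrite -[cube0 k.+1]/(bot 'I_k.+1) (negPf nw) => ->.
  refine (gcube_eq _ (tricube nN hc _)) => [s|s s' w ss'].
    by rewrite /pt /c; case: ifP => _ /=; rewrite antipode_top.
  rewrite /c /=; case: (eqVneq w (top _)) => [wt|nw].
    by have -> : s = s' by apply/ffunP => i; apply: ss'; rewrite wt ffunE.
  by case: ifP => _; case: ifP => _; rewrite ?c12'.
exists (fun=> x), (pt x y \o @antipode 'I_k.+1); split => //.
- exact/gcube_ord/gcube_const.
- by apply/gcube_ord/(gcube_comp (gmor_antipode (I := 'I_k.+1))).
- by rewrite /= (antipode_bot 'I_k.+1) pt_top.
move=> v nv /=; rewrite pt_neq //; apply: contraNneq nv => /(congr1 (@antipode 'I_k.+1)).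
by rewrite antipodeK antipode_top => ->.
Qed.

Lemma nil_rel_refl k (x : N) : nil_rel k x x.
Proof. by apply/nil_relP; apply: gcube_eq (gcube_const x) => w; rewrite /pt if_same. Qed.

Lemma nil_rel_sym k (x y : N) : nil_rel k x y -> nil_rel k y x.
Proof.
by case=> c1 [c2 [? ? ? ? c12]]; exists c2, c1; split=> // v /c12.
Qed.

Lemma nil_rel_trans k (x y z : N) : nil_rel k x y -> nil_rel k y z -> nil_rel k x z.
Proof.
move=> /nil_rel_sym/nil_relP h1 /nil_relP h2.
exists (pt y x \o @antipode 'I_k.+1), (pt y z \o @antipode 'I_k.+1); split.
- exact/gcube_ord/(gcube_comp (gmor_antipode (I := 'I_k.+1))).
- exact/gcube_ord/(gcube_comp (gmor_antipode (I := 'I_k.+1))).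
- by rewrite /= (antipode_bot 'I_k.+1) pt_top.
- by rewrite /= (antipode_bot 'I_k.+1) pt_top.
move=> v nv /=; have nv' : @antipode 'I_k.+1 v != top _.
  apply: contraNneq nv => /(congr1 (@antipode 'I_k.+1)).
  by rewrite antipodeK antipode_top => ->.
by rewrite !pt_neq.
Qed.

Lemma gcube_pt k (I : finType) (x y : N) :
  nil_rel k x y -> #|I| <= k.+1 -> gcube (pt x y : bcube I -> N).
Proof.
move=> /nil_relP h /(@gmor_all I predT)[psi hpsi psiE].
apply: gcube_pull h hpsi _ => w; rewrite /pt /= psiE.
congr (if _ then _ else _); apply/eqP/forall_inP => [-> i _|h]; first by rewrite ffunE.
by apply/ffunP => i; rewrite ffunE h.
Qed.

Lemma nil_relS k (x y : N) : nil_rel k.+1 x y -> nil_rel k x y.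
Proof. by move=> h; apply/nil_relP/(gcube_pt h); rewrite card_ord. Qed.

Lemma nil_rel_unique k (x y : N) : unique_completion k N -> nil_rel k x y -> x = y.
Proof.
move=> uN /nil_relP h; have := uN (fun=> x) (pt x y).
rewrite pt_top; apply; [exact/gcube_ord/gcube_const | exact/gcube_ord |].
by move=> v nv; rewrite pt_neq.
Qed.

Lemma nil_rel0 (x y : N) : nil_rel 0 x y.
Proof.
have [_ erg _] := (nilspaceP N).1 nN.
by apply/nil_relP/gcube_ord; rewrite erg.
Qed.

(** In [w] this runs from [top] (at w = 0) to [s] (at w = [top]). Hence the maps [c \o join_compl s]
    are the orthants of a tricube with centre [c (top I)] and outer cube [c]. *)
Definition join_compl (I : finType) (s w : bcube I) : bcube I :=
  [ffun i => if w i then s i else true].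

Lemma gmor_join_compl (I : finType) (s : bcube I) : gmor (join_compl s).
Proof.
apply: (gmor_ffun (F := fun i w => if w i then s i else true)) => i.
by case: (s i); [under eq_fun do rewrite if_same; apply: gcoord_const|
  under eq_fun do rewrite -[if _ then _ else _]/(~~ _); apply/gcoordN/gcoord_var].
Qed.

Lemma join_compl_top (I : finType) (s : bcube I) : join_compl s (top I) = s.
Proof. by apply/ffunP => i; rewrite !ffunE. Qed.

Lemma join_top (I : finType) (w : bcube I) : join_compl (top I) w = top I.
Proof. by apply/ffunP => i; rewrite !ffunE if_same. Qed.

Lemma eq_join_compl (I : finType) (s s' w : bcube I) :
  (forall i, w i -> s i = s' i) -> join_compl s w = join_compl s' w.
Proof. by move=> h; apply/ffunP => i; rewrite !ffunE; case: ifP => // /h. Qed.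

Lemma eq_of_top (I : finType) (s s' : bcube I) :
  (forall i, top I i -> s i = s' i) -> s = s'.
Proof. by move=> h; apply/ffunP => i; apply: h; rewrite ffunE. Qed.

(** In the tricube of the [c \o join_compl s] the top orthant is constant, equal to the centre; it
    may be exchanged for [pt (c (top I)) y], which differs from it only at the outer vertex. *)
Lemma replace_top k (I : finType) (c : bcube I -> N) y :
  #|I| <= k.+1 -> gcube c -> nil_rel k (c (top I)) y -> gcube (upd c (top I) y).
Proof.
move=> hI hc cy.
pose d (s : bcube I) := if s == top I then pt (c (top I)) y else c \o join_compl s.
apply: gcube_eq (tricube nN (c := d) _ _) => [s|s|s s' w ss'].
- rewrite /d /upd; case: ifP => _; first by rewrite pt_top.
  by rewrite /= join_compl_top.
- rewrite /d; case: ifP => _; first exact: gcube_pt cy hI.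
  exact: gcube_comp (gmor_join_compl s) hc.
rewrite /d /=; have [wt|nw] := eqVneq w (top I).
  by have -> : s = s' by apply: eq_of_top; rewrite -wt.
have := eq_join_compl ss'.
case: eqVneq => [->|_]; case: eqVneq => [->|_] //=; rewrite ?join_top ?(pt_neq _ _ nw).
- by move=> <-.
- by move=> ->.
- by move=> ->.
Qed.

(* Second use of [tricube]: each vertex of [c] is altered inside its own orthant,
   which makes all the alterations independent. *)
Lemma replace_cube k (I : finType) (c c' : bcube I -> N) :
  #|I| <= k.+1 -> gcube c -> (forall v, nil_rel k (c v) (c' v)) -> gcube c'.
Proof.
move=> hI hc cc'; pose d s := upd (c \o join_compl s) (top I) (c' s).
apply: gcube_eq (tricube nN (c := d) _ _) => [s|s|s s' w ss'].
- by rewrite /d upd_same.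
- apply: replace_top hI _ _; first exact: gcube_comp (gmor_join_compl s) hc.
  by rewrite /= join_compl_top.
rewrite /d /upd; case: eqVneq => [wt|_] /=; last by rewrite (eq_join_compl ss').
by have -> : s = s' by apply: eq_of_top; rewrite -wt.
Qed.

End NilRel.

(** * Cubes transported along a map *)

Definition image_of (N M : cubespace) (p : N -> M) : Prop :=
  forall n, cubes M n = [set p \o c | c in cubes N n].

Lemma gcube_image (N M : cubespace) (p : N -> M) (I : finType) (f : bcube I -> M) :
  image_of p -> gcube f <-> exists2 c, gcube c & p \o c = f.
Proof.
move=> hp; split=> [hf|[c hc <-]]; last first.
  by move=> n phi hphi; rewrite hp; exists (c \o phi) => //; apply: hc.
have := hf _ _ (@gmor_of_ord I); rewrite hp => -[c cN pc].
exists (c \o @to_ord I); first by apply: (gcube_comp (@gmor_to_ord I)); apply/gcube_ord.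
by apply/funext => w; rewrite /= -[p _]/((p \o c) _) pc /= to_ordK.
Qed.

Lemma image_nil_rel (N M : cubespace) (p : N -> M) k (x y : N) :
  image_of p -> nil_rel k x y -> nil_rel k (p x) (p y).
Proof.
move=> hp [c1 [c2 [c1N c2N <- <- c12]]].
exists (p \o c1), (p \o c2); split=> //; rewrite ?hp; [by exists c1|by exists c2|].
by move=> v /c12 /= ->.
Qed.

Lemma gluable_meet (M : cubespace) n (f : cube n -> M) (i : 'I_n) (v : cube n) :
  cubes M n.-1 (f \o face0 i) -> ~~ v i -> @gcube M 'I_n (f \o @meet 'I_n v).
Proof.
move=> fi vi; pose r (w : cube n) : cube n.-1 := [ffun j => w (lift i j)].
apply: (gcube_pull (J := 'I_n.-1) (f := f \o face0 i) (phi := r \o @meet 'I_n v)).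
- exact/gcube_ord.
- by apply: gmor_comp (gmor_meet v); apply: (gmor_res (I := 'I_n) (lift i)).
move=> w /=; congr f; apply/ffunP => j; rewrite !ffunE.
by case: unliftP => [j' ->|->]; rewrite ?ffunE// (negPf vi) andbF.
Qed.

Lemma meet_ext (I : finType) (v w : bcube I) :
  meet v w = ext (@enum_val I [pred i | v i]) (bot I)
    [ffun j => w (enum_val j)].
Proof.
apply/ffunP => i; rewrite !ffunE; case E: pinv => [j|].
  by rewrite ffunE -(pinv_some E); have := enum_valP j; rewrite inE => ->; rewrite andbT.
apply/negP => /andP[_ vi].
have Ai : i \in [pred i | v i] by [].
by move: E; rewrite -(enum_rankK_in Ai Ai) pinvK //; apply: enum_val_inj.
Qed.

(** * The nilspaces F_k(N) *)

Section NilFactor.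
Variable N : cubespace.
Hypothesis nN : nilspace N.

Lemma to_classP k (x y : N) : to_class k x = to_class k y <-> nil_rel k x y.
Proof.
split=> [/(congr1 (fun C : nil_class N k => sval C y)) /= ->|xy]; first exact: nil_rel_refl.
apply: eq_exist; apply/seteqP; split=> z /=; last exact: nil_rel_trans.
by apply: nil_rel_trans => //; apply: nil_rel_sym.
Qed.

Lemma to_class_surj k (C : nil_class N k) : exists x, to_class k x = C.
Proof. by case: C => S [x Sx]; exists x; apply: eq_exist. Qed.

Lemma image_nil_factor k : image_of (@to_class N k : N -> nil_factor N k).
Proof. by []. Qed.

(** Two lifts that are equivalent off the top can be made equal there by [replace_cube]: [d] follows
    [c] off the top and [c'] at the top. Comparing [c] with [d] relates their top values. *)
Lemma unique_nil_factor k : unique_completion k (nil_factor N k).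
Proof.
move=> _ _ [c cN <-] [c' c'N <-] cc' /=; apply/to_classP/nil_relP => //.
pose d := upd c (cube1 k.+1) (c' (cube1 k.+1)).
have dN : @gcube N 'I_k.+1 d.
  apply: (replace_cube nN (k := k) (c := c')); rewrite ?card_ord//; first exact/gcube_ord.
  move=> v; rewrite /d /upd; have [->|nv] := eqVneq v (cube1 k.+1).
    exact: nil_rel_refl.
  by apply/to_classP/esym/cc'.
apply/nil_relP => //.
exists (c \o @antipode 'I_k.+1), (d \o @antipode 'I_k.+1); split.
- by apply/gcube_ord/(gcube_comp (gmor_antipode (I := 'I_k.+1))); apply/gcube_ord.
- by apply/gcube_ord/(gcube_comp (gmor_antipode (I := 'I_k.+1))).
- by rewrite /= (antipode_bot 'I_k.+1).
- by rewrite /= (antipode_bot 'I_k.+1) /d upd_same.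
move=> v nv /=; rewrite /d /upd ifN //.
apply: contraNneq nv => /(congr1 (@antipode 'I_k.+1)).
by rewrite antipodeK (antipode_top 'I_k.+1) => ->.
Qed.

(* On the downset of points with at most k + 1 ones any lift of a corner is made
   of cubes by [replace_cube], hence extends to a cube; above it the projection of
   this cube is forced by [unique_nil_factor]. *)
Lemma nilspace_nil_factor k : nilspace (nil_factor N k).
Proof.
have [[x0] erg _] := (nilspaceP N).1 nN.
have [r rK] := choice (@to_class_surj k).
apply/nilspaceP; split; first exact: inhabits (to_class k x0).
  apply/seteqP; split=> // f _; exists (r \o f); first by rewrite erg.
  by apply/funext => v /=; rewrite rK.
move=> n f hf.
have fmeet (v : cube n) : v != cube1 n -> @gcube (nil_factor N k) 'I_n (f \o @meet 'I_n v).
  by move=> /(@neq_top 'I_n v)[i vi]; apply: gluable_meet (hf i) vi.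
have [u v /andP[vk nv] uv|v /andP[vk nv]|g gN gE] := @extend N nN 'I_n
  (fun v => (#|[pred i | v i]| <= k.+1) && (v != cube1 n)) (r \o f).
- apply/andP; split.
    by apply: leq_trans vk; apply: subset_leq_card; apply/fintype.subsetP => i; apply: uv.
  apply: contraNneq nv => u1; apply/eqP/ffunP => i.
  by have := uv i; rewrite u1 !ffunE => ->.
- pose e := ext (@enum_val 'I_n [pred i | v i]) (bot 'I_n).
  apply: (gcube_pull (f := r \o f \o e) _ (gmor_res (@enum_val 'I_n [pred i | v i]))); last first.
    by move=> w /=; rewrite meet_ext.
  have [c cN ce] : exists2 c, gcube c & @to_class N k \o c = f \o @meet 'I_n v \o e.
    apply/(gcube_image _ (image_nil_factor k)); apply: gcube_comp (fmeet _ nv).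
    exact: gmor_ext.
  apply: (replace_cube nN (k := k) (c := c)); rewrite ?card_ord// => w.
  apply/to_classP; rewrite /= rK -[LHS]/((@to_class N k \o c) w) ce /=.
  congr f; apply: meet_idl => i; rewrite ffunE; case E: pinv => [j|]; last by rewrite ffunE.
  by move=> _; rewrite -(pinv_some E); have := enum_valP j.
exists (@to_class N k \o g); first by exists g => //; apply/gcube_ord.
move=> v; have [m] := ubnP #|[pred i | v i]|; elim: m v => // m IH v vm nv.
have [vk|kv] := leqP #|[pred i | v i]| k.+1; first by rewrite /= gE ?vk//= rK.
have -> : f v = (f \o @meet 'I_n v) v by rewrite /= meet_idl.
apply: (unique_below (I := 'I_n) (@unique_nil_factor k) _ _ (ltnW kv)).
- by apply/(gcube_image _ (image_nil_factor k)); exists g.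
- exact: fmeet.
move=> u uv nuv; rewrite [RHS]/= meet_idl // IH //.
  by move: vm; rewrite ltnS; apply: leq_trans; apply: card_below.
apply: contraNneq nv => u1; apply/eqP/ffunP => i.
by have := uv i; rewrite u1 !ffunE => ->.
Qed.

(** A lift of the cube [pt] has dimension k + 1, within the range where its values can be moved
    inside their ~_(k+1)-classes onto those of [pt x y]. *)
Lemma nil_rel_nil_factor k (x y : N) :
  @nil_rel (nil_factor N k.+1) k (to_class k.+1 x) (to_class k.+1 y) <-> nil_rel k x y.
Proof.
split=> [|xy]; last exact: image_nil_rel (image_nil_factor _) xy.
move=> /(nil_relP (nilspace_nil_factor k.+1))/(gcube_image _ (image_nil_factor _))[c cN cE].
apply/(nil_relP nN)/(replace_cube nN (k := k.+1) _ cN); first by rewrite card_ord.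
move=> v; apply/to_classP; rewrite -[LHS]/((@to_class N k.+1 \o c) v) cE /pt.
by case: ifP.
Qed.

End NilFactor.

(** * The nilspaces D_K(A) *)

Section AlternatingSums.
Local Open Scope ring_scope.

Definition sg (I : finType) (v : bcube I) : int := (-1) ^+ (\sum_i v i)%N.
Definition flip (I : finType) (j : I) (v : bcube I) : bcube I :=
  [ffun i => if i == j then ~~ v i else v i].
Definition below (I : finType) (u v : bcube I) : bool := [forall i, u i ==> v i].

Lemma belowP (I : finType) (u v : bcube I) : reflect (forall i, u i -> v i) (below u v).
Proof. by apply: (iffP forallP) => h i; apply/implyP/h. Qed.

Lemma sgE (I : finType) (v : bcube I) : sg v = \prod_i (-1) ^+ (v i).
Proof. by rewrite /sg prodrXr. Qed.

Lemma sgM (I : finType) (v : bcube I) : sg v * sg v = 1.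
Proof. by rewrite /sg -exprD addnn -mul2n exprM sqrrN expr1n. Qed.

Lemma flipK (I : finType) (j : I) : involutive (flip j).
Proof. by move=> v; apply/ffunP => i; rewrite !ffunE; case: eqP => //; rewrite negbK. Qed.

Lemma sg_flip (I : finType) (j : I) (v : bcube I) : sg (flip j v) = - sg v.
Proof.
rewrite !sgE (bigD1 j)//= [in RHS](bigD1 j)//= ffunE eqxx -mulNr; congr (_ * _).
  by case: (v j); rewrite ?expr0 ?expr1 ?opprK.
by apply: eq_bigr => i /negPf ij; rewrite ffunE ij.
Qed.

Variable A : zmodType.

Lemma sum_flip (I : finType) (j : I) (P : pred (bcube I)) (f : bcube I -> A) :
  (forall v, P (flip j v) = P v) -> (forall v, f (flip j v) = f v) ->
  \sum_(v | P v) f v *~ sg v = 0.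
Proof.
move=> hP hf; rewrite (bigID (fun v : bcube I => v j)) /=.
rewrite [X in _ + X](reindex_inj (inv_inj (flipK j))) /=.
rewrite [X in _ + X](eq_big (fun v => P v && v j) (fun v => - (f v *~ sg v))).
- by rewrite sumrN subrr.
- by move=> v; rewrite hP ffunE eqxx negbK.
- by move=> v _; rewrite hf sg_flip mulrNz.
Qed.

(* Up to sign, the coefficients of [f] in the basis of multilinear monomials. *)
Definition mu (I : finType) (f : bcube I -> A) (u : bcube I) : A :=
  \sum_(v | below v u) f v *~ sg v.

(** After exchanging the sums, the coefficient of [f w] is a signed sum over the interval [w, v],
    which cancels in pairs under a flip unless w = v. *)
Lemma mu_inversion (I : finType) (f : bcube I -> A) (v : bcube I) :
  f v = \sum_(u | below u v) mu f u *~ sg u.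
Proof.
transitivity (\sum_w f w *~ sg w *~ (\sum_(u | below w u && below u v) sg u)).
  rewrite (bigD1 v)//= [X in _ + X]big1 ?addr0 => [|w nwv].
    rewrite (big_pred1 v) => [|u]; first by rewrite -mulrzA sgM.
    apply/andP/eqP => [[/belowP vu /belowP uv]|->]; last by split; apply/belowP.
    by apply/ffunP => i; apply/idP/idP => [/uv|/vu].
  have [/belowP wv|nwv'] := boolP (below w v); last first.
    rewrite big_pred0 ?mulr0z// => u; apply: contraNF nwv' => /andP[/belowP wu /belowP uv].
    by apply/belowP => i /wu/uv.
  have [j vj wj] : exists2 j, v j & ~~ w j.
    apply/exists_inP; apply: contraNT nwv => /exists_inPn h.
    by apply/eqP/ffunP => i; apply/idP/idP => [/wv|/h/negPn].
  suff -> : \sum_(u | below w u && below u v) sg u = 0 by rewrite mulr0z.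
  rewrite (bigID (fun u : bcube I => u j)) /=.
  rewrite [X in _ + X](reindex_inj (inv_inj (flipK j))) /=.
  rewrite [X in _ + X](eq_big (fun u => (below w u && below u v) && u j) (fun u => - sg u)).
  - by rewrite sumrN subrr.
  - move=> u; rewrite ffunE eqxx negbK; congr (_ && _ && _); apply/belowP/belowP => h i.
    + by move=> wi; have := h i wi; rewrite ffunE; case: eqP wi wj => // -> ->.
    + by move=> wi; have := h i wi; rewrite ffunE; case: eqP wi wj => // -> ->.
    + by have := h i; rewrite ffunE; case: eqP => // ->; rewrite vj.
    + by rewrite ffunE; case: eqP => [->|_ /h //]; rewrite vj.
  - by move=> u _; rewrite sg_flip.
under eq_bigr do rewrite mulrz_sumr.
under [RHS]eq_bigr do rewrite /mu mulrz_suml.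
rewrite [RHS](exchange_big_dep predT) //=.
by apply: eq_bigr => w _; apply: eq_bigl => u; rewrite andbC.
Qed.

End AlternatingSums.

(** * Cubes of D_K(A) as polynomials of degree at most K *)

Section GroupSpace.
Variables (K : nat) (A : zmodType).
Local Open Scope ring_scope.

Lemma group_cubes_dim0 : @group_cubes K A 0 = setT.
Proof.
apply/seteqP; split=> // f _ phi _.
apply: (sum_flip (j := @ord0 K) (P := predT)) => // v.
by congr f; apply/ffunP => -[].
Qed.

Lemma group_cubes_comp n m (phi : cube n -> cube m) (f : cube m -> A) :
  cube_morphism phi -> group_cubes K f -> group_cubes K (f \o phi).
Proof. by move=> hphi hf psi hpsi; apply: (hf (phi \o psi)); exact: gmor_comp hphi hpsi. Qed.

Definition group_space : cubespace :=
  @Cubespace A (@group_cubes K A) group_cubes_dim0 group_cubes_comp.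

Lemma sg_ext (I J : finType) (e : J -> I) (b : bcube I) (w : bcube J) :
  injective e -> (forall j, ~~ b (e j)) -> sg (ext e b w) = sg w * sg b.
Proof.
move=> inje hb; rewrite !sgE [in LHS](bigID (fun i => pinv e i)) /=.
rewrite [\prod_i (-1) ^+ b i](bigID (fun i => pinv e i)) /=.
rewrite [X in _ = _ * (X * _)]big1 ?mul1r => [|i]; last first.
  by case E: (pinv e i) => [j|//] _; rewrite -(pinv_some E) (negPf (hb j)).
congr (_ * _); last by apply: eq_bigr => i; rewrite ffunE; case: pinv.
rewrite (reindex_omap e (pinv e)) => [|i]; last first.
  by case E: (pinv e i) => [j|//] _; rewrite /= (pinv_some E).
apply: eq_big => j; first by rewrite pinvK // eqxx.
by rewrite extK.
Qed.

(** Choose K + 1 coordinates where [u] is 1 and group the points below [u] by their remaining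
    coordinates. Each group is a (K + 1)-face, over which the alternating sum vanishes. *)
Lemma mu_eq0 (I : finType) (f : bcube I -> A) (u : bcube I) :
  @gcube group_space I f -> (K < #|[pred i | u i]|)%N -> mu f u = 0.
Proof.
move=> hf Ku; pose e (j : 'I_K.+1) : I := enum_val (widen_ord Ku j).
have inje : injective e by move=> j j' /enum_val_inj /(congr1 val) /= /val_inj.
have ue j : u (e j) by have := enum_valP (widen_ord Ku j).
pose clear (v : bcube I) : bcube I := [ffun i => if pinv e i then false else v i].
rewrite /mu (partition_big clear predT) //= big1 // => b _.
have [/andP[/belowP bu /forallP be]|nb] := boolP (below b u && [forall j, ~~ b (e j)]); last first.
  rewrite big_pred0 // => v; apply: contraNF nb => /andP[/belowP vu /eqP <-].
  apply/andP; split.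
    by apply/belowP => i; rewrite ffunE; case: pinv => // /vu.
  by apply/forallP => j; rewrite ffunE pinvK.
rewrite (reindex_onto (ext e b) (fun v => [ffun j => v (e j)])); last first.
  move=> v /andP[_ /eqP <-]; apply/ffunP => i; rewrite !ffunE.
  by case E: pinv => [j|//]; rewrite ffunE (pinv_some E).
rewrite (eq_big predT (fun w => f (ext e b w) *~ sg w *~ sg b)) => [|w|w _].
- rewrite -mulrz_suml; have := hf _ _ (gmor_ext e b) id (@gmor_id _).
  by rewrite /sg /= => ->; rewrite mul0rz.
- apply/andP; split; [apply/andP; split|].
  + apply/belowP => i; rewrite ffunE; case E: pinv => [j|]; last exact: bu.
    by rewrite -(pinv_some E).
  + apply/eqP/ffunP => i; rewrite !ffunE; case E: pinv => [j|//].
    by rewrite -(pinv_some E) (negPf (be j)).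
  + by apply/eqP/ffunP => j; rewrite ffunE extK.
by rewrite sg_ext // mulrzA.
Qed.

Lemma gcube_group (I : finType) (f : bcube I -> A) :
  (forall phi : bcube 'I_K.+1 -> bcube I, gmor phi ->
    \sum_v f (phi v) *~ sg v = 0) -> @gcube group_space I f.
Proof. by move=> h n phi hphi psi hpsi; apply: (h (phi \o psi)); apply: (@gmor_comp 'I_K.+1 'I_n I). Qed.

Lemma gcoord_flip (I : finType) (p : bcube I -> bool) : gcoord p ->
  exists o : option I, forall j, Some j != o -> forall x, p (flip j x) = p x.
Proof.
case=> [e|e|[i e]|[i e]]; [exists None | exists None | exists (Some i) | exists (Some i)];
  move=> j nj x; rewrite !e // ffunE ifN //; by apply: contraNneq nj => ->.
Qed.

(** Each coordinate of [phi] depends on at most one variable, so the at most K coordinates in [u]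
    miss one of the K + 1 variables. Flipping that variable cancels the sum. *)
Lemma gcube_monomial (I : finType) (u : bcube I) (a : A) : (#|[pred i | u i]| <= K)%N ->
  @gcube group_space I (fun v => if below u v then a else 0).
Proof.
move=> uK; apply: gcube_group => phi hphi.
have [o ho] := choice (fun i => gcoord_flip (hphi i)).
have [j hj] : exists j, Some j \notin [set o i | i in [pred i | u i]]%SET.
  apply/existsP; apply: contraT => /existsPn h.
  have := leq_trans (leq_imset_card o [pred i | u i]) uK.
  rewrite leqNgt -{1}(card_ord K.+1) => /negP; case.
  rewrite -(card_imset predT (@Some_inj _)); apply: subset_leq_card.
  by apply/fintype.subsetP => _ /imsetP[j _ ->]; apply/negPn/h.
apply: (sum_flip (j := j) (P := predT)) => // v; congr (if _ then _ else _).
have e i : u i -> phi (flip j v) i = phi v i.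
  by move=> ui; apply: ho; apply: contraNneq hj => ->; apply: imset_f.
by apply/belowP/belowP => h i ui; have := h i ui; rewrite e.
Qed.

(** By [mu_inversion], [f] is a combination of monomials, here all of degree at most K. *)
Lemma mu_gcube (I : finType) (f : bcube I -> A) :
  (forall u : bcube I, (K < #|[pred i | u i]|)%N -> mu f u = 0) -> @gcube group_space I f.
Proof.
move=> hf; apply: gcube_group => phi hphi.
pose g (u v : bcube I) : A := if below u v then mu f u *~ sg u else 0.
transitivity (\sum_v \sum_u g u (phi v) *~ sg v).
  by apply: eq_bigr => v _; rewrite -mulrz_suml -big_mkcond -mu_inversion.
rewrite exchange_big big1 //= => u _.
have [uK|Ku] := leqP #|[pred i | u i]| K.
  exact: (@gcube_monomial I u _ uK _ _ hphi id (@gmor_id _)).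
by apply: big1 => v _; rewrite /g hf // mul0rz if_same mul0rz.
Qed.

Lemma gcube_small (I : finType) (f : bcube I -> A) :
  (#|I| <= K)%N -> @gcube group_space I f.
Proof.
move=> IK; apply: mu_gcube => u; rewrite ltnNge (leq_trans _ IK)//.
exact: max_card.
Qed.

Lemma gluing_group_space : gluing group_space.
Proof.
move=> n f hf; have [nK|Kn] := leqP n K.
  by exists f => //; apply/gcube_ord/gcube_small; rewrite card_ord.
pose t := top 'I_n.
(* The top value is the solution of [mu g t] = 0. Every other [mu g u] involves a proper face only,
   where the corner is already a cube. *)
pose g := upd f t (- (\sum_(v | v != t) f v *~ sg v) *~ sg t).
exists g; last by move=> v nv; rewrite /g /upd ifN.
apply/gcube_ord/mu_gcube => u Ku; have [->|nu] := eqVneq u t.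
  rewrite /mu (bigD1 t)/=; last by apply/belowP.
  rewrite {1}/g upd_same -mulrzA sgM -addrC; apply/eqP; rewrite subr_eq0; apply/eqP.
  apply: eq_big => v; first by rewrite andbC; case: eqP => //= _; apply/belowP => i; rewrite ffunE.
  by move=> /andP[_ nv]; rewrite /g /upd ifN.
have [i ui] := neq_top nu.
rewrite -(mu_eq0 (gluable_meet (M := group_space) (hf i) ui) Ku).
apply: eq_bigr => v /belowP vu /=; rewrite meet_idl // /g /upd ifN //.
by apply: contraNneq ui => vt; apply: vu; rewrite vt ffunE.
Qed.

End GroupSpace.

Lemma unique_group_space (K : nat) (A : zmodType) : unique_completion K (group_space K A).
Proof.
move=> c c' /(_ id (@gmor_id 'I_K.+1)) cN /(_ id (@gmor_id 'I_K.+1)) c'N cc'.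
have : (c (cube1 K.+1) *~ sg (cube1 K.+1) = c' (cube1 K.+1) *~ sg (cube1 K.+1))%R.
  rewrite -[LHS](addrK (\sum_(v | v != cube1 K.+1) c v *~ sg v)%R).
  move: cN c'N; rewrite /= (bigD1 (cube1 K.+1))//= => -> ; rewrite (bigD1 (cube1 K.+1))//=.
  move=> /eqP; rewrite addr_eq0 => /eqP ->; rewrite sub0r; congr (- _)%R.
  by apply: eq_bigr => v /cc' ->.
move=> /(congr1 (fun a => a *~ sg (cube1 K.+1))%R).
by rewrite -!mulrzA sgM.
Qed.

(** * Degree-k bundles are nilspaces *)

Lemma act_inj (A : zmodType) (S T : Type) (b : abelian_bundle A S T) (x : T) :
  injective (act b x).
Proof.
move=> a a' e; apply/eqP; rewrite -subr_eq0; apply/eqP.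
by apply: (@act_free _ _ _ b (act b x a')); rewrite -actD addrC subrK.
Qed.

(** The bundle condition at a single level, over any base, in a form that serves both directions. *)
Definition degree_extension (K : nat) (A : zmodType) (S : Type) (M : cubespace)
    (b : abelian_bundle A S M) : Prop :=
  forall n (c : cube n -> M), cubes M n c ->
    [set c2 | cubes M n c2 /\ bundle_proj b \o c = bundle_proj b \o c2]
    = [set (fun v => act b (c v) (c3 v)) | c3 in @group_cubes K A n].

(** * Lifting the axioms along one bundle projection *)

Section DegreeExtension.
Variables (i : nat) (A : zmodType) (L M : cubespace) (b : abelian_bundle A L M).
Hypothesis bM : degree_extension i.+1 b.
Hypothesis qM : image_of (bundle_proj b : M -> L).

Lemma cubes_act n (c : cube n -> M) (a : cube n -> A) : cubes M n c ->
  cubes M n (fun v => act b (c v) (a v)) <-> group_cubes i.+1 a.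
Proof.
move=> cM; have e := bM cM; split=> [aM|aN].
  have : [set c2 | cubes M n c2 /\ bundle_proj b \o c = bundle_proj b \o c2]
      (fun v => act b (c v) (a v)).
    by split=> //; apply/funext => v /=; apply/bundle_proj_orbit; exists (a v).
  rewrite e => -[a' a'N aa'].
  suff -> : a = a' by [].
  by apply/funext => v; apply: (@act_inj _ _ _ b (c v));
    rewrite -[RHS]/((fun v => act b (c v) (a' v)) v) aa'.
have : [set (fun v => act b (c v) (c3 v)) | c3 in @group_cubes i.+1 A n]
      (fun v => act b (c v) (a v)) by exists a.
by rewrite -e => -[].
Qed.

(** In dimension at most i + 1 every map is a cube of D_(i+1)(A), so being a cube is decided in the
    base. *)
Lemma cubes_over n (c f : cube n -> M) : n <= i.+1 ->
  cubes M n c -> bundle_proj b \o c = bundle_proj b \o f -> cubes M n f.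
Proof.
move=> ni cM cf.
have /choice[a fa] v : exists a, f v = act b (c v) a.
  by apply/bundle_proj_orbit; apply: (congr1 (@^~ v) cf).
have -> : f = (fun v => act b (c v) (a v)) by apply/funext.
by apply/cubes_act => //; apply/(@gcube_ord (group_space i.+1 A))/gcube_small; rewrite card_ord.
Qed.

Lemma degree_extension_step : step_nilspace i L -> step_nilspace i.+1 M.
Proof.
move=> /step_nilspaceP[nL uL]; have [[x0] erg glu] := (nilspaceP L).1 nL.
apply/step_nilspaceP; split.
  apply/nilspaceP; split.
  - by have [x _] := bundle_proj_surj b x0; exact: inhabits x.
  - apply/seteqP; split=> // f _.
    have : cubes L 1 (bundle_proj b \o f) by rewrite erg.
    by rewrite qM => -[c cM cf]; apply: cubes_over cf.
  move=> n f hf; have [j|g gL gf] := glu n (bundle_proj b \o f).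
    by rewrite qM; exists (f \o face0 j).
  move: gL gf; rewrite qM => -[c cM <-] cf.
  (* The correction from the lift [c] to [f]; its value at the top vertex is a default. *)
  have /choice[a fa] v : exists a, v != cube1 n -> f v = act b (c v) a.
    have [->|nv] := eqVneq v (cube1 n); first by exists 0%R.
    have /bundle_proj_orbit[a ->] := cf v nv; by exists a.
  have [j|a' a'N aa'] := @gluing_group_space i.+1 A n a.
    apply/(cubes_act (c := c \o face0 j)); first exact: (cubes_comp (gmor_face0 j) cM).
    suff -> : (fun v => act b ((c \o face0 j) v) ((a \o face0 j) v)) = f \o face0 j by apply: hf.
    by apply/funext => w /=; rewrite fa ?face0_neq1.
  exists (fun v => act b (c v) (a' v)); first exact/cubes_act.
  by move=> v nv; rewrite fa ?aa'.
move=> c c' cM c'M cc'.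
(* Uniqueness in [L] passes from dimension i + 1 to i + 2. So [c] and [c'] differ by a cube of
   D_(i+1)(A) that vanishes off the top, hence everywhere. *)
have qc : bundle_proj b \o c = bundle_proj b \o c'.
  apply/funext => v; have [->|nv] := eqVneq v (cube1 i.+2); last by rewrite /= cc'.
  apply: (unique_completionS uL (c := bundle_proj b \o c) (c' := bundle_proj b \o c')).
  - by rewrite qM; exists c.
  - by rewrite qM; exists c'.
  by move=> w nw /=; rewrite cc'.
have /choice[a ca] v : exists a, c' v = act b (c v) a.
  by apply/bundle_proj_orbit; apply: (congr1 (@^~ v) qc).
have aN : group_cubes i.+1 a.
  apply/(cubes_act _ cM); suff <- : c' = (fun v => act b (c v) (a v)) by [].
  exact/funext.
have zN : group_cubes i.+1 (fun _ : cube i.+2 => 0%R : A).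
  by apply/(cubes_act _ cM); rewrite (_ : (fun v => _) = c) //; apply/funext => v; rewrite act0.
have e := unique_group_space aN zN; rewrite ca e ?act0// => v nv.
by apply: (@act_inj _ _ _ b (c v)); rewrite -ca act0 cc'.
Qed.

End DegreeExtension.

(** * The cubespace induced by a surjection *)

Section ImageSpace.
Variables (N : cubespace) (T : Type) (p : N -> T).
Hypothesis p_surj : forall t, exists x, p x = t.

Lemma image_cubes_dim0 : [set p \o c | c in cubes N 0] = setT.
Proof.
apply/seteqP; split=> // f _; have [x xE] := p_surj (f (cube0 0)).
exists (fun=> x); first by rewrite cubes_dim0.
by apply/funext => v /=; rewrite xE; congr f; apply/ffunP => -[].
Qed.

Lemma image_cubes_comp n m (phi : cube n -> cube m) (f : cube m -> T) :
  cube_morphism phi -> [set p \o c | c in cubes N m] f ->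
  [set p \o c | c in cubes N n] (f \o phi).
Proof. by move=> hphi [c cN <-]; exists (c \o phi) => //; apply: cubes_comp. Qed.

Definition image_space : cubespace :=
  @Cubespace T (fun n => [set p \o c | c in cubes N n]) image_cubes_dim0 image_cubes_comp.

Lemma image_ofP : image_of (p : N -> image_space).
Proof. by []. Qed.

End ImageSpace.

Lemma cubes_bij (N M : cubespace) (p : N -> M) n (c : cube n -> N) :
  image_of p -> bijective p -> cubes M n (p \o c) <-> cubes N n c.
Proof.
move=> hp [q pK qK]; rewrite hp; split=> [[c' c'N e]|cN]; last by exists c.
suff -> : c = c' by [].
by apply/funext => v; apply: (can_inj pK); rewrite -[LHS]/((p \o c) v) -e.
Qed.

Lemma step_nilspace_bij k (N M : cubespace) (p : N -> M) :
  image_of p -> bijective p -> step_nilspace k M -> step_nilspace k N.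
Proof.
move=> hp bp; have cp n c := @cubes_bij _ _ p n c hp bp; case: (bp) => q pK qK.
move=> /step_nilspaceP[/nilspaceP[[x0] erg glu] uM]; apply/step_nilspaceP; split.
  apply/nilspaceP; split; first exact: inhabits (q x0).
    by apply/seteqP; split=> // f _; apply/cp; rewrite erg.
  move=> n f hf; have [j|g gM gf] := glu n (p \o f); first exact/cp/hf.
  exists (q \o g); last by move=> v nv /=; rewrite gf //= pK.
  by apply/cp; rewrite (_ : p \o _ = g) //; apply/funext => v /=; rewrite qK.
move=> c c' /cp cM /cp c'M cc'; apply: (can_inj pK).
by apply: (uM _ _ cM c'M) => v nv /=; rewrite cc'.
Qed.

(** * Climbing the tower of factors *)

Section Forward.
Variables (k : nat) (N : cubespace) (B : fold_bundle k N).

(** Downward induction from level k, where [proj] is bijective; hence i is written as k - (k -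
    i). *)
Lemma proj_surj i : i <= k -> forall t : factor B i, exists x, proj B i x = t.
Proof.
move=> ik; rewrite -(subKn ik); elim: (k - i) (leq_subr i k) => [|m IH] mk t.
  move: t; rewrite subn0 => t; have [g _ gK] := proj_top B; by exists (g t).
have mk' : k - m.+1 < k by rewrite ltn_subrL (leq_trans _ mk).
have e : (k - m.+1).+1 = k - m by rewrite subnSK.
have [y yt] := bundle_proj_surj (bundle B mk') t.
have {}IH : forall s : factor B (k - m.+1).+1, exists x, proj B (k - m.+1).+1 x = s.
  by rewrite e; apply: IH; apply: ltnW.
by have [x xy] := IH y; exists x; rewrite (projS B mk') xy.
Qed.

Definition factor_space i (ik : i <= k) : cubespace := image_space (proj_surj ik).

Lemma image_bundle_proj i (ik : i < k) :
  image_of (bundle_proj (bundle B ik) : factor_space ik -> factor_space (ltnW ik)).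
Proof.
move=> n; apply/seteqP; split=> f [c].
  move=> cN <-; exists (proj B i.+1 \o c); first by exists c.
  by apply/funext => v /=; rewrite (projS B ik).
by move=> [d dN <-] <-; exists d => //; apply/funext => v /=; rewrite (projS B ik).
Qed.

Hypothesis dB : degree_bundle B.

Lemma degree_extension_bundle i (ik : i < k) :
  @degree_extension i.+1 _ (factor_space (ltnW ik)) (factor_space ik) (bundle B ik).
Proof. by move=> n c cN; apply: dB. Qed.

Lemma step_factor i (ik : i <= k) : step_nilspace i (factor_space ik).
Proof.
elim: i ik => [|i IH] ik; last first.
  exact: (degree_extension_step (@degree_extension_bundle i ik)
    (@image_bundle_proj i ik) (IH (ltnW ik))).
have [t0 t0P] := factor0_point B.
have constE n (f g : cube n -> factor B 0) : f = g.
  by apply/funext => v; rewrite (t0P (f v)) (t0P (g v)).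
apply/step_nilspaceP; split; last by move=> c c' _ _ _; rewrite (constE _ c c').
have cubeP n (f : cube n -> factor_space ik) : cubes (factor_space ik) n f.
  have [x _] := proj_surj ik t0; exists (fun=> x); last exact: constE.
  exact/gcube_ord/gcube_const.
apply/nilspaceP; split; first exact: inhabits t0.
  by apply/seteqP; split.
by move=> n f _; exists f.
Qed.

Lemma image_proj_top : image_of (proj B k : N -> factor_space (leqnn k)).
Proof. by []. Qed.

Lemma step_nilspace_bundle : step_nilspace k N.
Proof.
exact: (step_nilspace_bij image_proj_top (proj_top B)) (step_factor (leqnn k)).
Qed.

(** If x and y agree in T_i, then [pt x y] is constant there. It has dimension i + 1, so
    [cubes_over] lifts it through every level j >= i up to N. Conversely ~_i is equality in the
    i-step nilspace T_i. *)
Lemma proj_nil_rel i (x y : N) : i <= k -> proj B i x = proj B i y <-> nil_rel i x y.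
Proof.
move=> ik; split=> [xy|xy]; last first.
  have /step_nilspaceP[nT uT] := step_factor ik.
  apply: (nil_rel_unique nT uT (x := proj B i x) (y := proj B i y)).
  exact: image_nil_rel (image_ofP _) xy.
have /step_nilspaceP[nN _] := step_nilspace_bundle.
apply/(nil_relP nN)/gcube_ord/(cubes_bij _ image_proj_top (proj_top B)).
suff h j (jk : j <= k) : i <= j -> cubes (factor_space jk) i.+1 (proj B j \o pt x y).
  exact: h.
elim: j jk => [|j IH] jk; rewrite leq_eqVlt => /predU1P[ij|//].
- subst i; exists (fun=> x); first exact/gcube_ord/gcube_const.
  by apply/funext => v /=; rewrite /pt; case: ifP.
- subst i; exists (fun=> x); first exact/gcube_ord/gcube_const.
  by apply/funext => v /=; rewrite /pt; case: ifP.
rewrite ltnS => ij; have := IH (ltnW jk) ij.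
have -> : proj B j \o pt (I := 'I_i.+1) x y =
    bundle_proj (bundle B jk) \o (proj B j.+1 \o pt x y).
  by apply/funext => v /=; rewrite (projS B jk).
rewrite (image_bundle_proj jk) => -[c cT ce].
exact: (cubes_over (@degree_extension_bundle j jk) _ cT ce).
Qed.

Lemma factor_is_nil i : i <= k -> factor_is_nil_factor B i.
Proof.
move=> ik; split; first by move=> x y; apply: proj_nil_rel.
have /step_nilspaceP[nN _] := step_nilspace_bundle.
have [r rK] := choice (@to_class_surj N i).
have hE x : proj B i (r (to_class i x)) = proj B i x.
  by apply/proj_nil_rel => //; apply/(to_classP nN).
exists (proj B i \o r); split=> //.
  have [s sK] := choice (proj_surj ik); exists (to_class i \o s) => [C|t] /=.
    by rewrite -[RHS]rK; apply/(to_classP nN)/proj_nil_rel.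
  by rewrite hE.
move=> n f; split=> [[c cN <-]|[c cN e]].
  by exists c => //; apply/funext => v /=; rewrite hE.
exists c => //; apply/funext => v /=; rewrite -[RHS]rK; apply/(to_classP nN)/proj_nil_rel => //.
exact: (congr1 (@^~ v) e).
Qed.

End Forward.

(** * Nilspaces are degree-k bundles *)

(** Equality and choice on [T] come from classical axioms. The bijection [f] hides the construction
    and keeps only the group law. *)
Lemma zmod_exists (T : Type) (z : T) (add : T -> T -> T) (opp : T -> T) :
  associative add -> commutative add -> left_id z add -> left_inverse z opp add ->
  exists (A : zmodType) (f : A -> T),
    [/\ bijective f, f 0%R = z & forall a b, f (a + b)%R = add (f a) (f b)].
Proof.
move=> addA addC add0 addN.
pose C : choiceType := HB.pack T (gen_eqMixin T) (gen_choiceMixin T).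
pose Z := @GRing.isZmodule.Build C z opp add addA addC add0 addN.
pose A : zmodType := HB.pack C Z.
by exists A, id; split=> //; exists id.
Qed.

(** * Splitting coordinates into two blocks *)

Section Sums.
Variables I J : finType.
Definition lpart (v : bcube (I + J)%type) : bcube I := [ffun i => v (inl i)].
Definition rpart (v : bcube (I + J)%type) : bcube J := [ffun j => v (inr j)].
Definition glue (w : bcube I) (u : bcube J) : bcube (I + J)%type :=
  [ffun x => match x with inl i => w i | inr j => u j end].

Lemma lpart_glue w u : lpart (glue w u) = w.
Proof. by apply/ffunP => i; rewrite !ffunE. Qed.

Lemma rpart_glue w u : rpart (glue w u) = u.
Proof. by apply/ffunP => i; rewrite !ffunE. Qed.

Lemma glue_parts v : glue (lpart v) (rpart v) = v.
Proof. by apply/ffunP => -[x|x]; rewrite !ffunE. Qed.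

Lemma gmor_glue (L : finType) (phi : bcube L -> bcube I) (psi : bcube L -> bcube J) :
  gmor phi -> gmor psi -> gmor (fun v => glue (phi v) (psi v)).
Proof.
by move=> hphi hpsi [i|j]; under eq_fun do rewrite ffunE; [apply: hphi | apply: hpsi].
Qed.

Lemma gmor_lpart : gmor lpart.
Proof. exact: gmor_res. Qed.

Lemma gmor_rpart : gmor rpart.
Proof. exact: gmor_res. Qed.

Lemma lpart_meet v w : lpart (meet v w) = meet (lpart v) (lpart w).
Proof. by apply/ffunP => i; rewrite !ffunE. Qed.

Lemma rpart_meet v w : rpart (meet v w) = meet (rpart v) (rpart w).
Proof. by apply/ffunP => i; rewrite !ffunE. Qed.

Lemma lpart_top : lpart (top _) = top I.
Proof. by apply/ffunP => i; rewrite !ffunE. Qed.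
End Sums.

Lemma meet_eq_top (I : finType) (v w : bcube I) :
  meet v w = top I -> v = top I /\ w = top I.
Proof.
move=> /ffunP h; split; apply/ffunP => i; have := h i; rewrite !ffunE; by case/andP.
Qed.

Lemma meet_bot (I : finType) (w : bcube I) : meet (bot I) w = bot I.
Proof. by apply/ffunP => i; rewrite !ffunE andbF. Qed.

(** * Prisms and translations *)

Section Prism.
Variables (k : nat) (M : cubespace).
Hypotheses (nM : nilspace M) (uM : unique_completion k.+1 M).
Let L := 'I_k.+1.

(** Extension from a downset whose faces carry either a copy of [c] or the cube [pt (c (bot J)) y].
    The values over the top of [L] at nonzero points of J are left to the extension. *)
Lemma cone (J : finType) (c : bcube J -> M) y : gcube c -> nil_rel k (c (bot J)) y ->
  exists2 g : bcube (L + J)%type -> M, gcube g & forall v,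
    (lpart v != top L -> g v = c (rpart v)) /\
    (lpart v = top L -> rpart v = bot J -> g v = y).
Proof.
move=> hc cy; pose f (v : bcube (L + J)%type) := if lpart v == top L then y else c (rpart v).
have [u v /orP Pv uv|v /orP Pv|g gM gE] :=
  @extend M nM (L + J)%type (fun v => (lpart v != top L) || (rpart v == bot J)) f.
- have le : meet v u = u by exact: meet_idl.
  case: Pv => [nv|/eqP v0]; apply/orP; [left|right].
    apply: contraNneq nv => u1; apply/eqP.
    by have /meet_eq_top[] : meet (lpart v) (lpart u) = top L by rewrite -lpart_meet le.
  by rewrite -le rpart_meet v0 meet_bot.
- have [v1|nv] := eqVneq (lpart v) (top L); last first.
    apply: gcube_pull hc (gmor_comp (@gmor_rpart L J) (gmor_meet v)) _ => w.
    rewrite /f /= ifN // lpart_meet; apply: contraNneq nv => /meet_eq_top[-> _] //.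
  case: Pv => [|/eqP v0]; first by rewrite v1 eqxx.
  have h : gcube (pt (c (bot J)) y : bcube L -> M) by apply: gcube_pt cy _; rewrite ?card_ord.
  apply: gcube_pull h (@gmor_lpart L J) _ => w.
  by rewrite /f /= lpart_meet v1 meet_top rpart_meet v0 meet_bot.
exists g => // v; split=> [nv|v1 v0].
  by rewrite gE ?nv// /f ifN.
by rewrite gE ?v0 ?eqxx ?orbT// /f v1 eqxx.
Qed.

(* [gcube (prism x y x' y')] says that the translation taking [x] to [y] takes
   [x'] to [y']. *)
Definition prism (x y x' y' : M) (v : bcube (L + unit)%type) : M :=
  if v (inr tt) then pt x' y' (lpart v) else pt x y (lpart v).

Lemma rpart_eq (v : bcube (L + unit)%type) (b : bool) : v (inr tt) = b -> rpart v = [ffun=> b].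
Proof. by move=> vb; apply/ffunP => -[]; rewrite !ffunE. Qed.

Lemma eq_top (v : bcube (L + unit)%type) : lpart v = top L -> v (inr tt) -> v = top _.
Proof.
move=> v1 vt; apply/ffunP => -[j|[]]; rewrite ffunE //.
by have /ffunP/(_ j) := v1; rewrite !ffunE.
Qed.

Lemma gcube_edge (x x' : M) : gcube (fun u : bcube unit => if u tt then x' else x).
Proof.
have [_ erg _] := (nilspaceP M).1 nM.
have h : @gcube M 'I_1 (fun u => if u ord0 then x' else x) by apply/gcube_ord; rewrite erg.
apply: (gcube_pull h (gmor_res (fun=> tt))) => u /=; by rewrite ffunE.
Qed.

Lemma prism_total x y x' : nil_rel k x y -> exists y', gcube (prism x y x' y').
Proof.
move=> xy; have [|g gM gE] := @cone unit _ y (gcube_edge x x'); first by rewrite ffunE.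
exists (g (top _)); apply: gcube_eq gM => v; rewrite /prism.
have [v1|nv] := eqVneq (lpart v) (top L).
  rewrite v1 !pt_top; case: ifPn => [vt|/negPf vt]; first by rewrite (eq_top v1 vt).
  by apply: (gE v).2 => //; apply: rpart_eq.
by rewrite (gE v).1 // !pt_neq // ffunE.
Qed.

Lemma prism_unique x y x' y1 y2 :
  gcube (prism x y x' y1) -> gcube (prism x y x' y2) -> y1 = y2.
Proof.
move=> h1 h2; have := unique_top uM h1 h2.
rewrite /prism !ffunE !lpart_top !pt_top; apply; first by rewrite card_sum card_ord card_unit addn1.
move=> v nv; case: ifP => // vt; rewrite !pt_neq //.
all: by apply: contraNneq nv => v1; apply/eqP/eq_top.
Qed.

Lemma prism_top x y x' y' : gcube (prism x y x' y') -> nil_rel k x' y'.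
Proof.
move=> h; apply/(nil_relP nM).
have hm : gmor (fun w : bcube L => glue w (top unit)).
  by apply: gmor_glue; [exact: gmor_id | exact: gmor_const].
apply: gcube_pull h hm _ => w.
by rewrite /prism /= !ffunE lpart_glue.
Qed.

Lemma prism_refl x y : nil_rel k x y -> gcube (prism x y x y).
Proof.
move=> /(nil_relP nM) h; apply: gcube_pull h (@gmor_lpart L unit) _ => v.
by rewrite /prism if_same.
Qed.

Lemma prism_const x x' : gcube (prism x x x' x').
Proof.
apply: gcube_pull (gcube_edge x x') (@gmor_rpart L unit) _ => v.
by rewrite /prism /pt !if_same /= ffunE.
Qed.

Lemma prism_sym x y x' y' : gcube (prism x y x' y') -> gcube (prism x' y' x y).
Proof.
move=> h; apply: gcube_pull h (gmor_glue (@gmor_lpart L unit)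
  (gmor_comp (gmor_antipode (I := unit)) (@gmor_rpart L unit))) _ => v.
rewrite /prism /= !ffunE lpart_glue; by case: (v (inr tt)).
Qed.

(** The two prisms are placed on either side of their common end (x', y') in the last direction; the
    outer cube of this tricube joins the two far ends. *)
Lemma prism_trans x y x' y' x'' y'' :
  gcube (prism x y x' y') -> gcube (prism x' y' x'' y'') -> gcube (prism x y x'' y'').
Proof.
move=> /prism_sym h1 h2.
pose f (b : bool) := if b then prism x' y' x'' y'' else prism x' y' x y.
have hf b : gcube (f b) by case: b.
pose c (s w : bcube (L + unit)%type) := f (s (inr tt)) (glue (meet (lpart s) (lpart w)) (rpart w)).
apply: gcube_eq (tricube nM (c := c) _ _) => [s|s|s s' w ss'].
- rewrite /c lpart_top /f /prism; case: (s (inr tt)); rewrite !ffunE lpart_glue;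
  by congr pt; apply/ffunP => i; rewrite !ffunE.
- apply: gcube_comp (hf _); apply: gmor_glue (@gmor_rpart _ _).
  exact: gmor_comp (gmor_meet _) (@gmor_lpart _ _).
rewrite /c; have -> : meet (lpart s) (lpart w) = meet (lpart s') (lpart w).
  by apply/ffunP => i; rewrite !ffunE; case E: (w (inl i)) => //=; rewrite ss'.
case E: (w (inr tt)); first by rewrite ss'.
by rewrite /f; case: (s _); case: (s' _); rewrite /prism !ffunE E.
Qed.

End Prism.

(** * The structure group on a class of ~_k *)

Section FiberBundle.
Variables (k : nat) (M : cubespace).
Hypotheses (nM : nilspace M) (uM : unique_completion k.+1 M).
Variable e : M.
Let L := 'I_k.+1.
Let F := {a : M | nil_rel k e a}.
Variable tr : M -> F -> M.
Hypothesis trP : forall x a, gcube (prism (k := k) e (sval a) x (tr x a)).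

Lemma tr_unique x (a : F) y : gcube (prism (k := k) e (sval a) x y) -> y = tr x a.
Proof. by move=> h; apply: (prism_unique uM h); apply: trP. Qed.

Lemma nil_rel_tr x a : nil_rel k x (tr x a).
Proof. exact: prism_top (trP x a). Qed.

(** The extension given by [cone] has no freedom over the top: between the points 0 and [rpart v] of
    J it is a prism, so by [prism_trans] its value there is the translate by [a]. *)
Lemma gcube_tr_cone (J : finType) (c : bcube J -> M) (a : F) : gcube c ->
  gcube (fun v : bcube (L + J)%type =>
    if lpart v == top L then tr (c (rpart v)) a else c (rpart v)).
Proof.
move=> hc; have [g gM gE] := cone nM hc (nil_rel_tr (c (bot J)) a).
apply: gcube_eq (gM) => v; have [v1|nv] := eqVneq (lpart v) (top L); last exact: (gE v).1.
apply: tr_unique; apply: prism_trans (trP (c (bot J)) a) _ => //.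
have hmor : gmor (fun w : bcube (L + unit)%type =>
    glue (lpart w) ([ffun j => w (inr tt) && rpart v j] : bcube J)).
  by apply: gmor_glue; [exact: gmor_lpart | apply: gmor_ffun => j; apply/gcoord_and/gcoord_var].
apply: gcube_pull gM hmor _ => w; rewrite /prism /=.
set u := [ffun j => _]; have uE : u = if w (inr tt) then rpart v else bot J.
  by apply/ffunP => j; rewrite ffunE; case: ifP; rewrite ?ffunE.
have [w1|nw] := eqVneq (lpart w) (top L).
  rewrite w1 !pt_top uE; case: ifP => wt; first by rewrite -v1 glue_parts.
  by rewrite (gE _).2 ?lpart_glue ?rpart_glue.
by rewrite !pt_neq // (gE _).1 ?lpart_glue // rpart_glue uE; case: ifP.
Qed.

(** Restriction of the cone over [c] to the graph of [psi]. With [psi] from [gmor_all], the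
    translated points form a face of codimension at most k + 1. *)
Lemma gcube_tr (I : finType) (c : bcube I -> M) (psi : bcube I -> bcube L) (a : F) :
  gcube c -> gmor psi -> gcube (fun v => if psi v == top L then tr (c v) a else c v).
Proof.
move=> hc hpsi; apply: gcube_pull (gcube_tr_cone a hc) (gmor_glue hpsi (@gmor_id I)) _ => v.
by rewrite /= lpart_glue rpart_glue.
Qed.

Let zero : F := exist _ e (nil_rel_refl nM k e).
Let add (a b : F) : F := exist _ (tr (sval a) b)
  (nil_rel_trans nM (svalP a) (nil_rel_tr (sval a) b)).

Lemma tr0 x : tr x zero = x.
Proof. by apply/esym/tr_unique/prism_const. Qed.

Lemma tr_base (a : F) : tr e a = sval a.
Proof. by apply/esym/tr_unique/(prism_refl nM)/(svalP a). Qed.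

(* Translating by [a] and then by [b] over the top of the first k + 1 coordinates
   turns the edge (e, x) into the prism that defines the translation of [x] by the
   point [tr a b]. *)
Lemma trD x a b : tr x (add a b) = tr (tr x a) b.
Proof.
apply/esym/tr_unique.
have h : gcube (fun v : bcube (L + unit)%type => if v (inr tt) then x else e).
  apply: gcube_pull (gcube_edge nM e x) (@gmor_rpart L unit) _ => v /=.
  by rewrite ffunE.
apply: gcube_eq (gcube_tr b (gcube_tr a h (@gmor_lpart _ _)) (@gmor_lpart _ _)) => v.
by rewrite /prism /pt; case: (v (inr tt)); case: (lpart v == _); rewrite /= ?tr_base.
Qed.

(* Translate the constant cube [e] by [b] over the top of the first k + 1
   coordinates and by [a] over the last one. *)
Lemma add_comm a b : sval (add a b) = sval (add b a).
Proof.
rewrite /=; apply/esym/tr_unique.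
have tmor : gmor (fun v : bcube (L + unit)%type => [ffun=> v (inr tt)] : bcube L).
  exact: gmor_res.
apply: gcube_eq (gcube_tr a (gcube_tr b (gcube_const e) (@gmor_lpart L unit)) tmor) => v.
have -> : ([ffun=> v (inr tt)] == top L) = v (inr tt).
  apply/eqP/idP => [/ffunP/(_ ord0)|vt]; first by rewrite !ffunE.
  by apply/ffunP => j; rewrite !ffunE.
by rewrite /prism /pt; case: (v (inr tt)); case: (lpart v == _); rewrite /= ?tr_base.
Qed.

Lemma tr_inverse (a : F) : exists b, sval (add a b) = e.
Proof.
(* The inverse [b] is the point to which the translation taking [a] to [e] takes [e]. *)
have [b hb] := prism_total nM e (nil_rel_sym (svalP a)).
have eb := prism_top nM hb; exists (exist _ b eb) => /=.
by apply/esym/tr_unique/prism_sym.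
Qed.

Lemma tr_transitive x y : nil_rel k x y <-> exists a, y = tr x a.
Proof.
split=> [xy|[a ->]]; last exact: nil_rel_tr.
have [a ha] := prism_total nM e xy.
have ea := prism_top nM ha; exists (exist _ a ea).
by apply/tr_unique/prism_sym.
Qed.

Lemma tr_free x a : tr x a = x -> sval a = e.
Proof.
move=> xa; have := prism_sym (trP x a); rewrite xa => h.
exact: (prism_unique uM h (prism_const nM x e)).
Qed.

Lemma structure_group : exists (A : zmodType) (f : A -> F),
  [/\ bijective f, f 0%R = zero & forall a b, f (a + b)%R = add (f a) (f b)].
Proof.
have F_eq (a b : F) : sval a = sval b -> a = b.
  by case: a b => [a ha] [b hb] /= ab; apply: eq_exist.
have /choice[opp oppP] a : exists b, add b a = zero.
  have [b hb] := tr_inverse a; exists b; apply: F_eq; by rewrite add_comm.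
apply: (@zmod_exists F zero add opp).
- by move=> a b c; apply: F_eq; rewrite /= trD.
- by move=> a b; apply/F_eq/add_comm.
- by move=> a; apply: F_eq; rewrite /= tr_base.
- exact: oppP.
Qed.

End FiberBundle.

(** * The bundle over the quotient by ~_k *)

Section Extension.
Variables (k : nat) (M : cubespace) (S : Type) (p : M -> S).
Hypotheses (nM : nilspace M) (uM : unique_completion k.+1 M).
Hypothesis pP : forall x y, p x = p y <-> nil_rel k x y.
Hypothesis p_surj : forall s, exists x, p x = s.

(** The quotient map is any surjection [p] with the right fibres, so that F_k(N) itself can serve as
    the base of F_(k+1)(N). *)
Lemma nilspace_bundle : exists (A : zmodType) (b : abelian_bundle A S M),
  bundle_proj b = p /\ degree_extension k.+1 b.
Proof.
have [[e] _ _] := (nilspaceP M).1 nM.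
have /choice[trp trpP] (q : M * {a : M | nil_rel k e a}) :
    exists y, gcube (prism (k := k) e (sval q.2) q.1 y).
  exact: prism_total (svalP q.2).
pose tr x a := trp (x, a).
have trP x a : gcube (prism (k := k) e (sval a) x (tr x a)) := trpP (x, a).
have [A [f [f_bij f0 fD]]] := structure_group nM uM trP.
have [g fK gK] := f_bij.
have act0 x : tr x (f 0%R) = x by rewrite f0; apply: tr0.
have actD x a b : tr x (f (a + b)%R) = tr (tr x (f a)) (f b) by rewrite fD; apply: trD.
have act_free x a : tr x (f a) = x -> a = 0%R.
  move=> /(tr_free nM uM trP) fa; apply: (can_inj fK); rewrite f0.
  by case: (f a) fa => z hz /= ze; apply: eq_exist.
have orb x y : p x = p y <-> exists a : A, y = tr x (f a).
  split=> [/pP/(tr_transitive nM uM trP)[a ->]|[a ->]]; first by exists (g a); rewrite gK.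
  by apply/pP/(tr_transitive nM uM trP); exists (f a).
pose b : abelian_bundle A S M := AbelianBundle act0 actD act_free orb p_surj.
have sub n (c : cube n -> M) (a : cube n -> A) : cubes M n c -> group_cubes k.+1 a ->
    cubes M n (fun v => act b (c v) (a v)).
  move=> cM /(@gcube_ord (group_space k.+1 A)) aN; apply/gcube_ord.
  have hc : @gcube M 'I_n c by apply/gcube_ord.
  (* The monomials of [a] are added one at a time: that of [u] translates the face of points above
     [u], of codimension at most k + 1, and those of higher degree vanish. *)
  have small (r : seq (bcube 'I_n)) : gcube (fun v : bcube 'I_n =>
      act b (c v) (\sum_(u <- r | below u v) (mu a u *~ sg u))%R).
    elim: r => [|u r IH].
      by apply: gcube_eq hc => v; rewrite big_nil Defs.act0.
    have [uk|ku] := leqP #|[pred i | u i]| k.+1; last first.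
      apply: gcube_eq IH => v; rewrite big_cons (mu_eq0 aN ku) mul0rz add0r.
      by rewrite if_same.
    have [psi hpsi psiE] := gmor_all uk.
    apply: gcube_eq (gcube_tr nM uM trP (f (mu a u *~ sg u)%R) IH hpsi) => v.
    rewrite big_cons psiE.
    have -> : [forall i in [pred i | u i], v i] = below u v by [].
    by case: ifP => // _; rewrite -[LHS]/(act b _ _) -Defs.actD addrC.
  apply: gcube_eq (small (index_enum _)) => v.
  by rewrite -mu_inversion.
exists A, b; split=> // n c cM; apply/seteqP; split=> [c2 [c2M cc2]|_ [a aN <-]]; last first.
  split; first exact: sub.
  by apply/funext => v /=; apply/orb; exists (a v).
have /choice[a ca] v : exists a, c2 v = act b (c v) a by apply/orb/(congr1 (@^~ v) cc2).
exists a; last by apply/funext => v; rewrite ca.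
(* The facets of [a1] have dimension k + 1, so they are cubes and [a1] can be corrected at the top
   to a cube [a']. Translating [c \o phi] by [a'] gives a cube equal to [c2 \o phi] off the top;
   unique completion forces [a1] = [a']. *)
move=> phi hphi; pose a1 := a \o phi.
have [i|a' a'N a'E] := @gluing_group_space k.+1 A k.+2 a1.
  by apply/gcube_ord/gcube_small; rewrite card_ord.
have a1E : a1 = a'.
  apply/funext => v; have [->|nv] := eqVneq v (cube1 k.+2); last by rewrite a'E.
  apply: (@act_inj _ _ _ b (c (phi (cube1 k.+2)))); rewrite -[a1 _]/(a (phi (cube1 k.+2))) -ca.
  have hc := cubes_comp hphi cM; have hc2 := cubes_comp hphi c2M.
  apply: (uM hc2 (sub _ _ _ hc a'N)) => w nw /=.
  by rewrite a'E // ca.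
have := a'N id (@gmor_id 'I_k.+2); by rewrite -a1E.
Qed.

End Extension.

(** * The tower of quotients F_i(N) *)

Section Tower.
Variables (N : cubespace).
Hypothesis nN : nilspace N.

Lemma class_bundle k : exists (A : zmodType)
    (b : abelian_bundle A (nil_class N k) (nil_factor N k.+1)),
  (forall x, bundle_proj b (to_class k.+1 x) = to_class k x) /\ degree_extension k.+1 b.
Proof.
have [r rK] := choice (@to_class_surj N k.+1).
have pE x : to_class k (r (to_class k.+1 x)) = to_class k x.
  by apply/(to_classP nN)/(nil_relS nN)/(to_classP nN); rewrite rK.
(* The projection between the quotients uses chosen representatives; by [pE] the choice is
   immaterial, as ~_(k+1) refines ~_k. *)
have [|C|A [b [bp bM]]] := @nilspace_bundle k (nil_factor N k.+1) _ (@to_class N k \o r)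
  (nilspace_nil_factor nN k.+1) (@unique_nil_factor _ nN k.+1).
- move=> C D /=; rewrite -{2}(rK C) -{2}(rK D).
  split=> [/(to_classP nN) h|/(nil_rel_nil_factor nN) h]; first exact/nil_rel_nil_factor.
  exact/to_classP.
- by have [x <-] := to_class_surj C; exists (to_class k.+1 x); apply: pE.
by exists A, b; split=> // x; rewrite bp; apply: pE.
Qed.

Lemma degree_bundle_nil_factors k : unique_completion k N -> is_degree_bundle k N.
Proof.
move=> uN; pose tower i := cid (@class_bundle i).
pose bun i := cid (svalP (tower i)).
(* Structure groups are numbered from 1; the value at 0 is a default. *)
pose gr j := if j is i.+1 then sval (tower i) else sval (tower 0).
have point : exists t0 : nil_class N 0, forall t, t = t0.
  have [[x0] _ _] := (nilspaceP N).1 nN; exists (to_class 0 x0) => t.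
  by have [x <-] := to_class_surj t; apply/(to_classP nN)/nil_rel0.
have top_bij : bijective (@to_class N k).
  have [r rK] := choice (@to_class_surj N k); exists r => // x.
  by apply: (nil_rel_unique nN uN); apply/(to_classP nN); rewrite rK.
pose B : fold_bundle k N := @FoldBundle k N (nil_class N) gr
  (fun i _ => sval (bun i)) (@to_class N) point top_bij
  (fun i _ x => esym ((svalP (bun i)).1 x)).
by exists B => i ik n c cN; apply: (svalP (bun i)).2.
Qed.

End Tower.

Theorem theorem1 (k : nat) (N : cubespace) :
  (is_degree_bundle k N <-> step_nilspace k N) /\
  (forall B : fold_bundle k N, degree_bundle B ->
     forall i : nat, 1 <= i <= k -> factor_is_nil_factor B i).
Proof.
split; last by move=> B dB i /andP[_ ik]; apply: factor_is_nil.
split=> [[B dB]|/step_nilspaceP[nN uN]]; first exact: step_nilspace_bundle dB.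
exact: degree_bundle_nil_factors.
Qed.
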